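(* Let $\mu$ be a Borel measure on $\mathbb R$ with $\mu(\mathbb R)=1$. Let $f\in C^1(\mathbb R)$ be Lipschitz continuous on $\mathbb R$ and suppose there is a constant $\alpha\in(0,1)$ with $f(0)=f(\alpha)=f(1)=0$, $f<0$ on $(0,\alpha)$ and $f>0$ on $(\alpha,1)$. Suppose $f'(\alpha)>0$. Then there exist a constant $c\in\mathbb R$ and a monotone function $\phi$ on $\mathbb R$ with $\phi(-\infty)=0$ and $\phi(+\infty)=1$ such that $u(t,x):=\phi(x+ct)$ is a solution to \[u_t=\mu*u-u+f(u).\]
   Context: The convolution is $(\mu*u)(x)=\int_{y\in\mathbb R}u(x-y)\,d\mu(y)$ for bounded Borel-measurable $u$. The map $u\mapsto \mu*u-u+f(u)$ is Lipschitz from $L^\infty(\mathbb R)$ to $L^\infty(\mathbb R)$, so the equation generates a flow on $L^\infty(\mathbb R)$; ''solution'' refers to solutions of this ODE in $L^\infty(\mathbb R)$. The measure $\mu$ need not be absolutely continuous with respect to Lebesgue measure. *)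

(* Defs.v *)
From HB Require Import structures.
From mathcomp Require Import all_boot all_order all_algebra.
From mathcomp Require Import all_classical all_reals all_analysis.
Set Implicit Arguments. Unset Strict Implicit. Unset Printing Implicit Defensive.
Import Order.TTheory GRing.Theory Num.Theory.
Import numFieldNormedType.Exports.
Local Open Scope classical_set_scope.
Local Open Scope ring_scope.

Definition conv {R : realType} (mu : {measure set (measurableTypeR R) -> \bar R})
  (u : R -> R) (x : R) : R :=
  fine (\int[mu]_(y in [set: measurableTypeR R]) (u (x - y))%:E).

(* u : time -> (space -> value) is a solution of u_t = mu*u - u + f(u) as an
   ODE in L^\infty(R): for every t, u t is a bounded Borel-measurable function
   and t |-> u t is differentiable in the L^\infty (essential sup) norm with
   derivative mu*(u t) - u t + f(u t).  The L^\infty norm of the difference is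
   encoded as "for Lebesgue-a.e. x, |...| <= e". *)
Definition is_Linf_solution {R : realType}
  (mu : {measure set (measurableTypeR R) -> \bar R}) (f : R -> R)
  (u : R -> R -> R) : Prop :=
  (forall t, measurable_fun [set: measurableTypeR R] (u t) /\
             exists M : R, forall x, `|u t x| <= M) /\
  (forall t (e : R), 0 < e -> exists2 d : R, 0 < d &
     forall h : R, 0 < `|h| < d ->
       {ae (@lebesgue_measure R), forall x : measurableTypeR R,
          `|(u (t + h) x - u t x) / h - (conv mu (u t) x - u t x + f (u t x))|
            <= e}).

(* Main.v *)
(** A monotone profile [phi] solves [c phi' = mu * phi - phi + f phi] iff it is
    a fixed point of the order-preserving operator
    [phi |-> E (react (phi (x - c s - Y)) (phi (x - c s)))], where [s] is an
    exponential and [Y] a [mu]-distributed variable; [c] is here the speed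
    divided by a large constant [L]. On a window [0, h], with the values 0 on
    the left and 1 on the right, Tarski's theorem gives a fixed point for
    every speed. Compare its value at the middle of the window with [alpha]:
    it is above for very negative speeds, below for very positive ones, so for
    large [h] there are nearby speeds of both kinds, converging along a
    subsequence to some [c]. Helly limits of these solutions, recentred at a
    level below or above [alpha], are of four kinds: fronts from 0 to 1;
    monostable profiles from 0 to [alpha] or from [alpha] to 1; half-line
    subsolutions vanishing on the left; half-line supersolutions equal to 1 on
    the right. A half-line subsolution and a half-line supersolution can be
    ordered by a shift, and then Tarski's theorem gives a front between them.
    In all remaining cases there are both a profile from 0 to [alpha] and one
    from [alpha] to 1 with the same speed [c]. Truncate [mu] so that
    [f' alpha > 0] absorbs the lost mass; integrating the two inequalities near
    [alpha] shows that the truncated mean of [c s + Y] is positive and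
    negative, which is absurd unless [Y = 0] almost surely. In that last case
    the Heaviside function is a stationary front. *)

Require Import Defs.
From HB Require Import structures.
From mathcomp Require Import all_boot all_order all_algebra.
From mathcomp Require Import all_classical all_reals all_analysis.
From mathcomp Require Import measurable_realfun ring lra.
Import Order.TTheory GRing.Theory Num.Theory.
Import numFieldNormedType.Exports.
Local Open Scope classical_set_scope.
Local Open Scope ring_scope.
Set Implicit Arguments.
Unset Strict Implicit.
Unset Printing Implicit Defensive.

(** * Expectation of bounded functions *)

Section BoundedExpectation.
Context d (T : measurableType d) (R : realType) (P : probability T R).

Implicit Types (g : T -> R) (r a b M : R).

Definition bdd_meas (g : T -> R) :=
  measurable_fun setT g /\ exists M : R, forall w, `|g w| <= M.

Lemma bdd_meas_integrable g : bdd_meas g -> P.-integrable setT (EFin \o g).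
Proof.
move=> [mg [M gM]]; apply: measurable_bounded_integrable => //.
  by apply: le_lt_trans (probability_le1 P measurableT) _; rewrite ltry.
by exists M; split; [exact: num_real|move=> N MN x _; exact: le_trans (gM x) (ltW MN)].
Qed.

Lemma bdd_meas_cst r : bdd_meas (fun=> r).
Proof. by split; [exact: measurable_cst|exists `|r|]. Qed.

Lemma bdd_measD g1 g2 : bdd_meas g1 -> bdd_meas g2 ->
  bdd_meas (fun w => g1 w + g2 w).
Proof.
move=> [m1 [M1 b1]] [m2 [M2 b2]]; split; first exact: measurable_funD.
by exists (M1 + M2) => w; apply: le_trans (ler_normD _ _) (lerD _ _).
Qed.

Lemma bdd_measM g1 g2 : bdd_meas g1 -> bdd_meas g2 ->
  bdd_meas (fun w => g1 w * g2 w).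
Proof.
move=> [m1 [M1 b1]] [m2 [M2 b2]]; split; first exact: measurable_funM.
by exists (M1 * M2) => w; rewrite normrM ler_pM.
Qed.

Lemma bdd_measZ r g : bdd_meas g -> bdd_meas (fun w => r * g w).
Proof. by move=> bg; apply: bdd_measM => //; exact: bdd_meas_cst. Qed.

Lemma bdd_measB g1 g2 : bdd_meas g1 -> bdd_meas g2 ->
  bdd_meas (fun w => g1 w - g2 w).
Proof.
move=> b1 b2.
rewrite (_ : (fun w => _) = (fun w => g1 w + (-1) * g2 w)).
  by apply: bdd_measD => //; exact: bdd_measZ.
by apply/funext => w; rewrite mulN1r.
Qed.

Lemma bdd_meas_indic (A : set T) : measurable A -> bdd_meas (\1_A : T -> R).
Proof.
move=> mA; split; first exact: measurable_indic.
by exists 1 => w; rewrite indicE; case: (_ \in _); rewrite ?normr0 ?normr1.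
Qed.

Lemma bdd_meas_range g a b : measurable_fun setT g ->
  (forall w, a <= g w <= b) -> bdd_meas g.
Proof.
move=> mg gab; split => //; exists (`|a| + `|b|) => w.
have /andP[ga gb] := gab w; rewrite ler_norml; apply/andP; split.
  rewrite lerNl (le_trans (y := `|a|)) ?lerDl//.
  by rewrite (le_trans (y := - a)) ?lerN2// -normrN ler_norm.
by rewrite (le_trans gb)// (le_trans (ler_norm _))// lerDr.
Qed.

Local Notation "''E' g" := (\int[P]_w g w)%R (at level 10, g at level 8).

Lemma expect_le g1 g2 : bdd_meas g1 -> bdd_meas g2 ->
  (forall w, g1 w <= g2 w) -> 'E g1 <= 'E g2.
Proof.
by move=> b1 b2 g12; apply: le_Rintegral => //; apply: bdd_meas_integrable.
Qed.

Lemma expect_cst r : \int[P]_w r = r.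
Proof.
rewrite Rintegral_cst// (_ : fine _ = 1) ?mulr1//.
exact: (congr1 fine (probability_setT P)).
Qed.

Lemma expectD g1 g2 : bdd_meas g1 -> bdd_meas g2 ->
  \int[P]_w (g1 w + g2 w) = 'E g1 + 'E g2.
Proof. by move=> b1 b2; apply: RintegralD => //; apply: bdd_meas_integrable. Qed.

Lemma expectB g1 g2 : bdd_meas g1 -> bdd_meas g2 ->
  \int[P]_w (g1 w - g2 w) = 'E g1 - 'E g2.
Proof. by move=> b1 b2; apply: RintegralB => //; apply: bdd_meas_integrable. Qed.

Lemma expectZ r g : bdd_meas g -> \int[P]_w (r * g w) = r * 'E g.
Proof. by move=> bg; apply: RintegralZl => //; apply: bdd_meas_integrable. Qed.

Lemma expect_range g a b : bdd_meas g -> (forall w, a <= g w <= b) ->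
  a <= 'E g <= b.
Proof.
move=> bg gab; apply/andP; split.
  rewrite -[leLHS]expect_cst; apply: expect_le => //; first exact: bdd_meas_cst.
  by move=> w; have /andP[] := gab w.
rewrite -[leRHS]expect_cst; apply: expect_le => //; first exact: bdd_meas_cst.
by move=> w; have /andP[] := gab w.
Qed.

Lemma expect_cvg (g_ : nat -> T -> R) (g : T -> R) (M : R) :
  (forall n, measurable_fun setT (g_ n)) -> measurable_fun setT g ->
  (forall n w, `|g_ n w| <= M) -> (forall w, (g_ n w @[n --> \oo]) --> g w) ->
  (\int[P]_w g_ n w @[n --> \oo]) --> 'E g.
Proof.
move=> mg_ mg gM gg.
have [] := @dominated_convergence _ T R P setT measurableT
  (fun n => EFin \o g_ n) (EFin \o g) (EFin \o cst M).
- by move=> n; apply/measurable_EFinP.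
- exact/measurable_EFinP.
- by apply: aeW => w _; apply/fine_cvgP; split; [exact: nearW|exact: gg].
- by apply: bdd_meas_integrable; exact: bdd_meas_cst.
- by apply: aeW => w n _; rewrite /= lee_fin.
move=> intg _ cv; apply: fine_cvg.
rewrite fineK//; apply: integrable_fin_num => //.
Qed.

(** Reverse Fatou lemma: the positive part of [g_ n - g] is bounded by [2 * M] and tends to 0, so
    dominated convergence makes its mean vanish. At a jump of a Helly limit only such one-sided
    bounds are available. *)
Lemma expect_limsup_le (g_ : nat -> T -> R) (g : T -> R) (M : R)
    (a_ : nat -> R) (a : R) :
  (forall n, measurable_fun setT (g_ n)) -> measurable_fun setT g ->
  (forall n w, `|g_ n w| <= M) -> (forall w, `|g w| <= M) ->
  (forall w e, 0 < e -> \forall n \near \oo, g_ n w <= g w + e) ->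
  (\forall n \near \oo, a_ n <= 'E (g_ n)) -> a_ n @[n --> \oo] --> a -> a <= 'E g.
Proof.
move=> mg_ mg gM gM' gg ag ca.
have M0 : 0 <= M by rewrite (le_trans (normr_ge0 (g point)))//.
pose h n w := Num.max (g_ n w - g w) 0.
have mh n : measurable_fun setT (h n).
  by apply: measurable_maxr => //; apply: measurable_funB.
have hM n w : `|h n w| <= 2 * M.
  rewrite /h ger0_norm ?le_max ?lexx ?orbT// ge_max mulr_ge0// andbT.
  rewrite (le_trans (ler_norm _))// (le_trans (ler_normB _ _))//.
  by rewrite mulr2n mulrDl mul1r lerD.
have hb n : bdd_meas (h n) by split => //; exists (2 * M).
have gb : bdd_meas g by split => //; exists M.
have : (\int[P]_w h n w @[n --> \oo]) --> \int[P]_w (0 : R).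
  apply: (@expect_cvg _ _ (2 * M)) => // w.
  apply/cvgrPdist_le => e e0; near=> n.
  rewrite sub0r normrN ger0_norm ?le_max ?lexx ?orbT//.
  rewrite ge_max (ltW e0) andbT lerBlDl.
  by near: n; exact: gg.
rewrite expect_cst => ch.
have : ('E g + \int[P]_w h n w @[n --> \oo]) --> 'E g + 0.
  by apply: cvgD => //; exact: cvg_cst.
rewrite addr0 => cgh.
apply: (ler_cvg_to ca cgh); apply: filterS ag => n ag.
rewrite (le_trans ag)// -expectD//; apply: expect_le => //.
- by split => //; exists M.
- exact: bdd_measD.
- by move=> w; rewrite -lerBlDl /h le_max lexx.
Unshelve. all: by end_near. Qed.

Lemma expect_ge0_eq0 g : bdd_meas g -> (forall w, 0 <= g w) -> 'E g <= 0 ->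
  {ae P, forall w, g w = 0}.
Proof.
move=> bg g0 Eg.
have [mg _] := bg.
have H : (\int[P]_w `|(EFin \o g) w| = 0)%E.
  under eq_integral do rewrite /= ger0_norm//.
  apply/eqP; rewrite eq_le [X in _ && X]integral_ge0 ?andbT; last first.
    by move=> *; rewrite lee_fin.
  have fg : (\int[P]_w (g w)%:E)%E \is a fin_num.
    by apply: integrable_fin_num => //; exact: bdd_meas_integrable.
  by rewrite -(fineK fg) lee_fin.
have /ae_eq_integral_abs : measurable_fun setT (EFin \o g) by apply/measurable_EFinP.
move=> /(_ P measurableT)[/(_ H)].
move=> + _; apply: filterS => w H1; by case: (H1 I).
Qed.

Lemma expect_ae_ge0 g : bdd_meas g -> {ae P, forall w, 0 <= g w} -> 0 <= 'E g.
Proof.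
move=> [mg _] g0; have -> : 'E g = \int[P]_w Num.max (g w) 0.
  congr fine; apply: ae_eq_integral => //; first exact/measurable_EFinP.
    by apply/measurable_EFinP; exact: measurable_maxr.
  by apply: filterS g0 => w g0 _; rewrite /= max_l.
by apply: Rintegral_ge0 => w _; rewrite le_max lexx orbT.
Qed.

Lemma expect_ae_le g1 g2 : bdd_meas g1 -> bdd_meas g2 ->
  {ae P, forall w, g1 w <= g2 w} -> 'E g1 <= 'E g2.
Proof.
move=> b1 b2 g12; rewrite -subr_ge0 -expectB//; apply: expect_ae_ge0.
  exact: bdd_measB.
by apply: filterS g12 => w; rewrite subr_ge0.
Qed.

End BoundedExpectation.

(** * Monotone functions and Helly's selection *)

Section Subsequences.
Variable R : realType.
Implicit Types (u : nat -> nat -> R).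

(** Compactness of [[0, 1]^nat] (Tychonoff) gives a cluster point [p]; the indices are then picked
    one after another, the [N]-th making the first [N] coordinates [N.+1%:R^-1]-close to [p]. *)
Lemma diagonal_subsequence u : (forall k n, 0 <= u k n <= 1) ->
  exists s : nat -> nat, {homo s : m n / (m < n)%N} /\
    forall k, exists l : R, u k (s n) @[n --> \oo] --> l.
Proof.
move=> u01.
pose I01 : set R := [set` `[0, 1]].
pose X := prod_topology (fun _ : nat => R : topologicalType).
have cX : compact ([set f | forall i, I01 (f i)] : set X).
  apply: (@tychonoff nat (fun=> R : topologicalType) (fun=> I01)) => _.
  exact: segment_compact.
pose v n : X := fun k => u k n.
have [p [_ clp]] : [set f : X | forall i, I01 (f i)] `&` cluster (v n @[n --> \oo]) !=set0.
  apply: cX; exists 0%N => // n _ i /=; by rewrite /I01/= in_itv/= u01.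
have near_p (N n0 : nat) : exists n, (n0 < n)%N /\
    forall k, (k < N)%N -> `|u k n - p k| < N.+1%:R^-1.
  pose A := [set f : X | forall k, (k < N)%N -> `|f k - p k| < N.+1%:R^-1].
  have nA : nbhs p A.
    have : nbhs p [set f : X | forall k : 'I_N, `|f k - p k| < N.+1%:R^-1].
      apply: (@filter_forall X 'I_N (fun k f => `|f k - p k| < N.+1%:R^-1) (nbhs p)) => k.
      have /cvgrPdist_lt /(_ N.+1%:R^-1) : (f : X) k @[f --> p] --> p k.
        exact: (@proj_continuous nat (fun=> R : topologicalType) (nat_of_ord k) p).
      rewrite invr_gt0 ltr0n => /(_ isT).
      by apply: filterS => f; rewrite distrC.
    by apply: filterS => f Hf k kN; exact: (Hf (Ordinal kN)).
  have nB : (v n @[n --> \oo]) [set f | exists n, (n0 < n)%N /\ f = v n].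
    by exists n0.+1 => // n /= n0n; exists n.
  have [f [[n [n0n ->]] Af]] := clp _ _ nB nA.
  by exists n.
pose nxt N n0 := sval (cid (near_p N n0)).
pose s := fix s n := if n is m.+1 then nxt m.+1 (s m) else nxt 0%N 0%N.
have sS n : (s n < s n.+1)%N.
  by have [] := svalP (cid (near_p n.+1 (s n))).
exists s; split; first by apply: homo_ltn => //; exact: ltn_trans.
have sn n k : (k < n)%N -> `|u k (s n) - p k| < n.+1%:R^-1.
  case: n => [//|n].
  by have [_] := svalP (cid (near_p n.+1 (s n))); exact.
move=> k; exists (p k); apply/cvgrPdist_lt => e e0; near=> n.
rewrite distrC (lt_trans (sn n k _))//; first by near: n; exact: nbhs_infty_gt.
near: n; exact: near_infty_natSinv_lt (PosNum e0).
Unshelve. all: by end_near. Qed.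

Lemma subseq_infty (s : nat -> nat) : {homo s : m n / (m < n)%N} ->
  s n @[n --> \oo] --> \oo.
Proof.
move=> ss.
have sn n : (n <= s n)%N.
  elim: n => // n IH; exact: leq_ltn_trans IH (ss _ _ _).
move=> A [N _ NA]; exists N => // n /= Nn; apply: NA => /=.
exact: leq_trans (sn n).
Qed.

(* The sequence [(1 + x_n)^-1] tells bounded from unbounded sequences. *)
Lemma cvg_inv_dichotomy (x : nat -> R) (l : R) : (forall n, 0 <= x n) ->
  (1 + x n)^-1 @[n --> \oo] --> l ->
  (forall M : R, \forall n \near \oo, M <= x n) \/
  exists M : R, \forall n \near \oo, x n <= M.
Proof.
move=> x0 cl.
have l0 : 0 <= l.
  apply: (ler_cvg_to (cvg_cst 0) cl); apply: nearW => n.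
  by rewrite invr_ge0 addr_ge0.
have x1 n : 0 < 1 + x n by rewrite ltr_pwDl.
have [lp|] := ltP 0 l; [right|move=> l0'; left].
  exists (l / 2)^-1.
  have l2 : 0 < l / 2 by lra.
  have := cvgr_gt l cl (l / 2); rewrite ltr_pdivrMr// => /(_ _)H.
  have {}H : \forall n \near \oo, l / 2 < (1 + x n)^-1 by apply: H; lra.
  apply: filterS H => n; rewrite -ltf_pV2 ?posrE ?invr_gt0// invrK => /ltW.
  by apply: le_trans; rewrite lerDr.
have {l0 l0'} l0 : l = 0 by apply/eqP; rewrite eq_le l0 l0'.
move=> M; pose N := `|M| + 1.
have N0 : 0 < N by rewrite /N ltr_wpDl.
have H : \forall n \near \oo, (1 + x n)^-1 < N^-1.
  by apply: (cvgr_lt l cl); rewrite l0 invr_gt0.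
apply: filterS H => n; rewrite ltf_pV2 ?posrE// /N => H.
have := ler_norm M; lra.
Qed.

End Subsequences.

Section Monotone.
Variable R : realType.
Implicit Types (phi psi u : R -> R).

Definition mon phi := {homo phi : x y / x <= y} /\ forall x, 0 <= phi x <= 1.

Lemma mon_cst r : 0 <= r <= 1 -> mon (fun=> r).
Proof. by move=> r01; split => // x y _. Qed.

Lemma mon_shift phi a : mon phi -> mon (fun x => phi (x + a)).
Proof.
by move=> [ph p01]; split => // x y xy; apply: ph; rewrite lerD2r.
Qed.

(** The pointwise supremum of all monotone [u] between the bounds with [u <= F u] stays in that
    family, and so does its image under [F], which forces equality. *)
Lemma mon_tarski (F : (R -> R) -> R -> R) (lo hi : R -> R) :
  (forall phi, mon phi -> mon (F phi)) ->
  (forall phi psi, mon phi -> mon psi -> (forall x, phi x <= psi x) ->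
    forall x, F phi x <= F psi x) ->
  mon lo -> mon hi -> (forall x, lo x <= F lo x) -> (forall x, F hi x <= hi x) ->
  (forall x, lo x <= hi x) ->
  exists phi, [/\ mon phi, forall x, F phi x = phi x,
    forall x, lo x <= phi x & forall x, phi x <= hi x].
Proof.
move=> Fm Fle mlo mhi loF hiF lohi.
pose A u := [/\ mon u, forall x, u x <= F u x,
  forall x, lo x <= u x & forall x, u x <= hi x].
have Alo : A lo by [].
pose B x : set R := [set u x | u in A].
pose phi x := sup (B x).
have B0 x : B x !=set0 by exists (lo x), lo.
have ubB x : ubound (B x) (hi x) by move=> _ [u [_ _ _ uhi] <-].
have Bphi u x : A u -> u x <= phi x.
  by move=> Au; apply: ub_le_sup; [exists (hi x)|exists u].
have phihi x : phi x <= hi x by apply: ge_sup.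
have mphi : mon phi.
  split; last first.
    move=> x; apply/andP; split.
      by apply: le_trans (Bphi _ x Alo); have /andP[] := mlo.2 x.
    by apply: le_trans (phihi x) _; have /andP[] := mhi.2 x.
  move=> x y xy; apply: ge_sup => // _ [u Au <-].
  by apply: le_trans (Bphi _ y Au); have [[+ _] _ _ _] := Au; apply.
have phiF x : phi x <= F phi x.
  apply: ge_sup => // _ [u Au <-]; have [mu uF _ _] := Au.
  by apply: le_trans (uF x) _; apply: Fle => // y; exact: Bphi.
have AF : A (F phi).
  split; [exact: Fm|by apply: Fle => //; exact: Fm| |].
    by move=> x; apply: le_trans (phiF x); exact: Bphi.
  by move=> x; apply: le_trans (hiF x); exact: Fle.
exists phi; split => // x; last exact: Bphi.
by apply/eqP; rewrite eq_le phiF andbT; exact: Bphi.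
Qed.

Lemma mon_measurable phi : mon phi -> measurable_fun setT phi.
Proof. by move=> [ph _]; apply: nondecreasing_measurable. Qed.

(** For a nondecreasing [phi] the infimum is the limit at -oo; [left_limit_cvg] turns this form into
    convergence along a filter. *)
Definition left_limit phi k :=
  (forall x, k <= phi x) /\ forall e, 0 < e -> exists x, phi x < k + e.

Definition right_limit phi k :=
  (forall x, phi x <= k) /\ forall e, 0 < e -> exists x, k - e < phi x.

Lemma mon_left_limit phi : mon phi -> exists2 k, 0 <= k <= 1 & left_limit phi k.
Proof.
move=> [ph p01].
have hi : has_inf (range phi).
  by split; [exists (phi 0), 0|exists 0 => _ [x _ <-]; have /andP[] := p01 x].
exists (inf (range phi)); last split.
- apply/andP; split.
    by apply: lb_le_inf; [case: hi|move=> _ [x _ <-]; have /andP[] := p01 x].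
  have /andP[_] := p01 0; apply: le_trans.
  by apply: ge_inf; [case: hi|exists 0].
- by move=> x; apply: ge_inf; [case: hi|exists x].
- by move=> e e0; have [_ [x _ <-] h] := inf_adherent e0 hi; exists x.
Qed.

Lemma mon_flip phi : mon phi -> mon (fun x => 1 - phi (- x)).
Proof.
move=> [ph p01]; split => [x y xy|x].
  by rewrite lerD2l lerN2 ph// lerN2.
by have /andP[p0 p1] := p01 (- x); rewrite subr_ge0 p1 gerBl p0.
Qed.

Lemma mon_right_limit phi : mon phi -> exists2 k, 0 <= k <= 1 & right_limit phi k.
Proof.
move=> /mon_flip/mon_left_limit[k /andP[k0 k1] [kphi kx]].
exists (1 - k); last split.
- by rewrite subr_ge0 k1 gerBl.
- by move=> x; have := kphi (- x); rewrite opprK; lra.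
- by move=> e /kx[x]; exists (- x); lra.
Qed.

(** The point is the supremum of the set where [phi < lev]. Nothing is claimed at [y] itself, where
    [phi] may jump. *)
Lemma mon_crossing phi lev a b : {homo phi : x y / x <= y} ->
  phi a < lev -> lev <= phi b ->
  exists y, [/\ a <= y <= b, forall x, x < y -> phi x < lev &
    forall x, y < x -> lev <= phi x].
Proof.
move=> ph pa pb; pose A := [set x | phi x < lev].
have ub x : A x -> x <= b.
  by move=> Ax; rewrite leNgt; apply/negP => /ltW/ph; rewrite leNgt (lt_le_trans Ax).
have sA : has_sup A by split; [exists a|exists b => x /ub].
exists (sup A); split.
- apply/andP; split; last by apply: ge_sup; [case: sA|exact: ub].
  by apply: ub_le_sup => //; case: sA.
- move=> x xs; have [z Az zx] := sup_gt (proj1 sA) xs.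
  by apply: le_lt_trans Az; exact/ph/ltW.
- move=> x xs; rewrite leNgt; apply/negP => Ax.
  by move: xs; rewrite ltNge ub_le_sup//; case: sA.
Qed.

(* Pointwise convergence of nondecreasing functions to the right-continuous
   [chi], at every continuity point of [chi]. *)
Definition mon_cvg (phi_ : nat -> R -> R) chi :=
  [/\ forall n, mon (phi_ n), mon chi,
    forall x e, 0 < e ->
      exists2 y, x < y & \forall n \near \oo, phi_ n y <= chi x + e &
    forall x y e, x < y -> 0 < e -> \forall n \near \oo, chi x - e <= phi_ n y].

Lemma mon_cvg_rcts (phi_ : nat -> R -> R) chi : mon_cvg phi_ chi -> forall x e, 0 < e ->
  exists2 y, x < y & chi y <= chi x + e.
Proof.
move=> [_ _ H1 H2] x e e0; have e2 : 0 < e / 2 by lra.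
have [z xz Hz] := H1 x _ e2; exists ((x + z) / 2); first lra.
have yz : (x + z) / 2 < z by lra.
near \oo => n.
have A : phi_ n z <= chi x + e / 2 by near: n.
have B : chi ((x + z) / 2) - e / 2 <= phi_ n z by near: n; exact: H2.
lra.
Unshelve. all: by end_near. Qed.

(** A diagonal subsequence converges at all rationals, and the limit is regularised from the right.
    The extra sequences [u] are carried along so that further quantities converge along the same
    subsequence. *)
Lemma helly (phi_ : nat -> R -> R) (u : nat -> nat -> R) :
  (forall n, mon (phi_ n)) -> (forall k n, 0 <= u k n <= 1) ->
  exists s chi, [/\ {homo s : m n / (m < n)%N},
    forall k, exists l : R, u k (s n) @[n --> \oo] --> l &
    mon_cvg (fun n => phi_ (s n)) chi].
Proof.
move=> mphi u01.
(* Even indices of [v] code values at rationals and odd ones the sequences [u]. The default 0 only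
   serves indices that code no rational. *)
pose q k : R := ratr (odflt 0 (unpickle k : option rat)).
pose v k n := if odd k then u k./2 n else phi_ n (q k./2).
have v01 k n : 0 <= v k n <= 1 by rewrite /v; case: ifP => // _; exact: (mphi n).2.
have [s [hs cs]] := diagonal_subsequence v01.
have cu k : exists l : R, u k (s n) @[n --> \oo] --> l.
  have [l] := cs k.*2.+1; rewrite /v /= odd_double/= uphalf_double => cl.
  by exists l.
have cq (r : rat) : {l : R | phi_ (s n) (ratr r) @[n --> \oo] --> l}.
  apply: cid; have [l] := cs (pickle r).*2.
  rewrite /v odd_double/= doubleK /q pickleK/= => cl.
  by exists l.
pose g r := sval (cq r); have gP r : phi_ (s n) (ratr r) @[n --> \oo] --> g r.
  exact: svalP (cq r).
have g01 r : 0 <= g r <= 1.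
  apply/andP; split.
    apply: (ler_cvg_to (cvg_cst 0) (gP r)); apply: nearW => n.
    by have /andP[] := (mphi (s n)).2 (ratr r).
  apply: (ler_cvg_to (gP r) (cvg_cst (1 : R))); apply: nearW => n.
  by have /andP[] := (mphi (s n)).2 (ratr r).
pose G (x : R) := [set g r | r in [set r : rat | x < ratr r]].
have G0 x : G x !=set0.
  have [r] : exists r : rat, ratr r \in `]x, (x + 1)[.
    by apply: rat_in_itvoo; rewrite ltrDl.
  by rewrite in_itv/= => /andP[xr _]; exists (g r), r.
have lG x : has_lbound (G x) by exists 0 => _ [r _ <-]; have /andP[] := g01 r.
(* The infimum over rationals strictly to the right makes [chi] right-continuous. *)
pose chi x := inf (G x).
have chile x r : x < ratr r -> chi x <= g r.
  by move=> xr; apply: ge_inf => //; exists r.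
have chi_adh x e : 0 < e -> exists2 r : rat, x < ratr r & g r < chi x + e.
  move=> e0; have [_ [r xr <-] h] := inf_adherent e0 (conj (G0 x) (lG x)).
  by exists r.
exists s, chi; split => //; split.
- by move=> n; exact: mphi.
- split=> [x y xy|x].
    apply: lb_le_inf => // _ [r /= yr <-]; apply: chile; exact: le_lt_trans yr.
  apply/andP; split.
    by apply: lb_le_inf => // _ [r _ <-]; have /andP[] := g01 r.
  have [_ [r xr _]] := G0 x; apply: le_trans (chile _ _ xr) _.
  by have /andP[] := g01 r.
- move=> x e e0; have [r xr gr] := chi_adh x e e0.
  exists (ratr r) => //; have := cvgr_le (g r) (gP r) _ gr.
  exact.
- move=> x y e xy e0.
  have [r] := rat_in_itvoo xy; rewrite in_itv/= => /andP[xr ry].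
  have : g r - e < g r by lra.
  move=> /(cvgr_ge (g r) (gP r)); apply: filterS => n h.
  rewrite (le_trans _ (le_trans h ((mphi (s n)).1 _ _ (ltW ry))))//.
  by rewrite lerD2r chile.
Qed.

End Monotone.

(** * Mean displacement of monostable profiles *)

Section StepSums.
Variables (R : realType) (v : R -> R) (eta : R).
Hypothesis v_mon : mon v.
Hypothesis eta_gt0 : 0 < eta.

(** Up to the factor [eta], a Riemann sum of [v] over a grid to the left of [x]; it plays the role
    of an antiderivative of [v]. *)
Definition step_sum n x := \sum_(k < n) v (x - k%:R * eta).

Let v_ge0 x : 0 <= v x. Proof. by have /andP[] := v_mon.2 x. Qed.

Lemma step_sum_le n x y : x <= y -> step_sum n x <= step_sum n y.
Proof. by move=> xy; apply: ler_sum => k _; apply: v_mon.1; rewrite lerD2r. Qed.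

Lemma step_sum_step n x :
  step_sum n (x - eta) + v x = step_sum n x + v (x - n%:R * eta).
Proof.
have <- : \sum_(k < n.+1) v (x - k%:R * eta) = step_sum n x + v (x - n%:R * eta).
  by rewrite big_ord_recr.
rewrite big_ord_recl/= mul0r subr0 addrC; congr (_ + _).
apply: eq_bigr => k _; congr v.
by rewrite /bump/= natrD; ring.
Qed.

Lemma step_sum_shiftr n x (j : nat) :
  step_sum n x - j%:R * v x <= step_sum n (x - j%:R * eta).
Proof.
elim: j => [|j IH]; first by rewrite !mul0r !subr0.
have -> : x - j.+1%:R * eta = x - j%:R * eta - eta by rewrite -natr1; ring.
have := step_sum_step n (x - j%:R * eta).
have : v (x - j%:R * eta) <= v x.
  by apply: v_mon.1; rewrite gerBl mulr_ge0// ltW.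
have := v_ge0 (x - j%:R * eta - n%:R * eta).
rewrite -natr1 mulrDl mul1r; lra.
Qed.

(** Each move to the right gains a term at least [v x] and drops the leftmost one, which during [N]
    moves never exceeds [v (x - (n%:R - N%:R) * eta)]. *)
Lemma step_sum_shiftl n x (N j : nat) : (j <= N)%N ->
  step_sum n x + j%:R * (v x - v (x - (n%:R - N%:R) * eta)) <=
  step_sum n (x + j%:R * eta).
Proof.
elim: j => [|j IH] jN; first by rewrite !mul0r !addr0.
have {}IH := IH (ltnW jN).
have := step_sum_step n (x + j.+1%:R * eta).
have -> : x + j.+1%:R * eta - eta = x + j%:R * eta by rewrite -natr1; ring.
have : v x <= v (x + j.+1%:R * eta).
  by apply: v_mon.1; rewrite lerDl mulr_ge0// ltW.
have : v (x + j.+1%:R * eta - n%:R * eta) <= v (x - (n%:R - N%:R) * eta).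
  apply: v_mon.1; rewrite -subr_ge0.
  have -> : x - (n%:R - N%:R) * eta - (x + j.+1%:R * eta - n%:R * eta) =
    (N%:R - j.+1%:R) * eta by ring.
  by apply: mulr_ge0; [rewrite subr_ge0 ler_nat|exact: ltW].
move=> A B C.
have -> : j.+1%:R * (v x - v (x - (n%:R - N%:R) * eta)) =
  j%:R * (v x - v (x - (n%:R - N%:R) * eta)) + (v x - v (x - (n%:R - N%:R) * eta)).
  by rewrite -natr1; ring.
lra.
Qed.

(* Discrete substitute for the convexity of an antiderivative of [v]. *)
Lemma step_sum_shift n x (N : nat) z : `|z| <= N%:R * eta ->
  step_sum n x - (z / eta + 1) * v x - N%:R * v (x - (n%:R - N%:R) * eta) <=
  step_sum n (x - z).
Proof.
rewrite ler_norml => /andP[zl zr].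
have e_ge0 := v_ge0 (x - (n%:R - N%:R) * eta).
have Ne_ge0 : 0 <= N%:R * v (x - (n%:R - N%:R) * eta) by rewrite mulr_ge0.
(* In both cases [x - z] is rounded down to a grid point, at the price of the [+ 1] in the
   statement. *)
have [z0|z0] := leP 0 z.
  have ze0 : 0 <= z / eta by rewrite divr_ge0// ltW.
  have /andP[t1 t2] := truncn_itv ze0.
  set j := (Num.truncn (z / eta)).+1 in t2.
  have jz : j%:R <= z / eta + 1 by rewrite /j -natr1 lerD2r.
  apply: le_trans (step_sum_le n (_ : x - j%:R * eta <= x - z)); last first.
    by rewrite lerD2l lerN2 -ler_pdivrMr// ltW.
  apply: le_trans (step_sum_shiftr n x j).
  have := ler_wpM2r (v_ge0 x) jz; lra.
have ze0 : 0 <= - z / eta by rewrite divr_ge0 ?ltW// oppr_gt0.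
have /andP[t1 t2] := truncn_itv ze0.
set j := Num.truncn (- z / eta) in t1 t2.
have jN : (j <= N)%N.
  rewrite -(ler_nat R) (le_trans t1)// ler_pdivrMr//; lra.
apply: le_trans (step_sum_le n (_ : x + j%:R * eta <= x - z)); last first.
  by rewrite lerD2l -ler_pdivlMr.
apply: le_trans (step_sum_shiftl n x jN).
have jz : - (z / eta) - 1 <= j%:R by move: t2; rewrite -natr1 mulNr; lra.
have := ler_wpM2r (v_ge0 x) jz.
have := ler_wpM2r e_ge0 (_ : (j%:R : R) <= N%:R); rewrite ler_nat => /(_ jN).
lra.
Qed.

End StepSums.

(* Take [v], nondecreasing and vanishing at -oo, with
   [v x >= E (v (x - Z1) + (L - 1 + delta) v (x - Z2)) / L] where [v] is small.
   Once [Z1] and [Z2] are truncated, the right-hand side still has total mass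
   larger than 1, and summing the inequality over a fine grid to the left of a
   point shows that the mean displacement [drift] is positive. *)
Section Drift.
Context d (T : measurableType d) (R : realType) (P : probability T R).
Variables (Z1 Z2 : T -> R) (L delta eta : R) (v G : R -> R).
Hypothesis mZ1 : measurable_fun setT Z1.
Hypothesis mZ2 : measurable_fun setT Z2.
Hypothesis L_gt1 : 1 < L.
Hypothesis delta_gt0 : 0 < delta.
Hypothesis eta_gt0 : 0 < eta.

Definition trunc_set (K : R) := [set w | `|Z1 w| <= K /\ `|Z2 w| <= K].

Definition drift K :=
  \int[P]_w (\1_(trunc_set K) w * (Z1 w + (L - 1 + delta) * Z2 w)).

Lemma measurable_trunc_set K : measurable (trunc_set K).
Proof.
have H (Z : T -> R) : measurable_fun setT Z -> measurable [set w | `|Z w| <= K].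
  move=> mZ; have mZ' : measurable_fun setT (fun w => `|Z w|).
    exact: measurableT_comp.
  have := mZ' measurableT _ (measurable_itv `]-oo, K]).
  by rewrite setTI; congr measurable; apply/seteqP; split => w /=; rewrite in_itv.
exact: measurableI (H _ mZ1) (H _ mZ2).
Qed.

(** The truncation sets exhaust the space, so their mass tends to 1. Above the threshold one has
    [(L + delta) * mass > L]: the gain [delta] outweighs the mass lost by truncation. *)
Lemma trunc_mass : exists K : nat,
  L / (L + delta) < \int[P]_w \1_(trunc_set K%:R) w.
Proof.
have c1 : (\int[P]_w (\1_(trunc_set n%:R) w : R) @[n --> \oo]) --> \int[P]_w (1 : R).
  apply: (@expect_cvg _ _ _ P _ _ 1).
  - by move=> n; apply: measurable_indic; exact: measurable_trunc_set.
  - exact: measurable_cst.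
  - by move=> n w; rewrite indicE; case: (_ \in _); rewrite ?normr0 ?normr1.
  - move=> w; apply/cvgrPdist_le => e e0; near=> n.
    rewrite indicE mem_set ?subrr ?normr0 ?ltW//; split.
      near: n; exact: nbhs_infty_ger.
    near: n; exact: nbhs_infty_ger.
rewrite expect_cst in c1.
have Ld0 : 0 < L + delta by rewrite addr_gt0// (lt_trans _ L_gt1).
have Ld : L / (L + delta) < 1 by rewrite ltr_pdivrMr// mul1r ltrDl.
have H : \forall n \near \oo, L / (L + delta) < \int[P]_w \1_(trunc_set n%:R) w.
  exact: (cvgr_gt _ c1).
by near \oo => n; exists n; near: n.
Unshelve. all: by end_near. Qed.
Lemma drift_bdd (K : R) :
  bdd_meas (fun w => \1_(trunc_set K) w * (Z1 w + (L - 1 + delta) * Z2 w)).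
Proof.
split.
  apply: measurable_funM; first by apply: measurable_indic; exact: measurable_trunc_set.
  by apply: measurable_funD => //; exact: measurable_funM.
exists (`|K| + `|L - 1 + delta| * `|K|) => w.
rewrite indicE; case: (boolP (w \in _)) => [/set_mem[z1 z2]|_]; last first.
  by rewrite mul0r normr0 addr_ge0// mulr_ge0.
rewrite mul1r (le_trans (ler_normD _ _))// lerD ?(le_trans z1) ?ler_norm//.
by rewrite normrM ler_wpM2l// (le_trans z2)// ler_norm.
Qed.

Hypothesis v_mon : mon v.
Hypothesis v_left : forall e, 0 < e -> exists x, v x < e.
Hypothesis v_gt0 : exists x, 0 < v x.
Hypothesis G_ge0 : forall x, 0 <= G (v x).
Hypothesis G_lin : forall x, v x <= eta -> delta * v x <= G (v x).
Let integrand x w := (v (x - Z1 w) + ((L - 1) * v (x - Z2 w) + G (v (x - Z2 w)))) / L.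
Hypothesis bint : forall x, bdd_meas (integrand x).
Hypothesis v_super : forall x, \int[P]_w integrand x w <= v x.

Let L_gt0 : 0 < L. Proof. exact: lt_trans L_gt1. Qed.
Let v_ge0 x : 0 <= v x. Proof. by have /andP[] := v_mon.2 x. Qed.

(** Let [s] be the end of the zero set of [v]. At [s - r] the mean of a nonnegative integrand
    vanishes, so almost surely [s - r - Z1] and [s - r - Z2] do not exceed [s]; then [r] runs
    through [n.+1%:R^-1]. *)
Lemma drift_degenerate x : v x = 0 -> {ae P, forall w, 0 <= Z1 w /\ 0 <= Z2 w}.
Proof.
move=> vx0; have [y vy] := v_gt0.
have [s [_ slt sgt]] : exists s, [/\ x - 1 <= s <= y,
    forall z, z < s -> v z = 0 & forall z, s < z -> 0 < v z].
  pose A := [set z | v z = 0].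
  have ub z : A z -> z <= y.
    move=> Az; rewrite leNgt; apply/negP => /ltW /v_mon.1.
    by rewrite Az leNgt vy.
  have sA : has_sup A by split; [exists x|exists y => z /ub].
  exists (sup A); split.
  - apply/andP; split; last by apply: ge_sup; [exists x|exact: ub].
    by apply: le_trans (ub_le_sup sA.2 vx0); lra.
  - move=> z zs; have [t At zt] := sup_gt sA.1 zs.
    by apply/eqP; rewrite eq_le v_ge0 andbT -At; exact/v_mon.1/ltW.
  - move=> z sz; rewrite lt_neqAle v_ge0 andbT eq_sym; apply/eqP => Az.
    by move: sz; rewrite ltNge (ub_le_sup sA.2 Az).
have H (n : nat) : {ae P, forall w, - n.+1%:R^-1 <= Z1 w /\ - n.+1%:R^-1 <= Z2 w}.
  have n0 : 0 < (n.+1%:R : R)^-1 by rewrite invr_gt0.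
  set r := (n.+1%:R : R)^-1 in n0 *; pose z := s - r.
  have vz : v z = 0 by apply: slt; rewrite /z; lra.
  have int_ge0 w : 0 <= integrand z w.
    apply: divr_ge0; last exact: ltW.
    by do 2 apply: addr_ge0 => //; apply: mulr_ge0 => //; rewrite subr_ge0 ltW.
  have : {ae P, forall w, integrand z w = 0}.
    by apply: expect_ge0_eq0 => //; rewrite -vz.
  apply: filterS => w /eqP; rewrite mulf_eq0 invr_eq0 (gt_eqF L_gt0) orbF.
  have a := v_ge0 (z - Z1 w).
  have b : 0 <= (L - 1) * v (z - Z2 w) by rewrite mulr_ge0// subr_ge0 ltW.
  rewrite !paddr_eq0 ?addr_ge0// => /andP[/eqP v1 /andP[]].
  rewrite mulf_eq0 gt_eqF ?subr_gt0//= => /eqP v2 _.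
  have K (t : R) : v (z - t) = 0 -> - r <= t.
    move=> vt; rewrite leNgt; apply/negP => tn.
    have : 0 < v (z - t) by apply: sgt; rewrite /z; lra.
    by rewrite vt ltxx.
  by split; exact: K.
have := ae_foralln H; apply: filterS => w Hw.
have K (t : R) : (forall n, - n.+1%:R^-1 <= t) -> 0 <= t.
  move=> Ht; apply/ler_addgt0Pr => e e0.
  near \oo => n; have := Ht n; have : n.+1%:R^-1 < e.
    by near: n; exact: (near_infty_natSinv_lt (PosNum e0)).
  by set r := _^-1; lra.
by split; apply: K => n; have [] := Hw n.
Unshelve. all: by end_near. Qed.

Section Truncated.
Variable K : nat.
Hypothesis K_mass : L / (L + delta) < \int[P]_w \1_(trunc_set K%:R) w.

Let chi w : R := \1_(trunc_set K%:R) w.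
Let trunc_int (g : R -> R) x w :=
  chi w * (g (x - Z1 w) + (L - 1 + delta) * g (x - Z2 w)).

Let mchi : measurable_fun setT chi.
Proof. by apply: measurable_indic; exact: measurable_trunc_set. Qed.

Let chi01 w : 0 <= chi w <= 1.
Proof. by rewrite /chi indicE; case: (_ \in _); rewrite ?lexx ?ler01. Qed.

Let chi_Z w : chi w != 0 -> `|Z1 w| <= K%:R /\ `|Z2 w| <= K%:R.
Proof.
by rewrite /chi indicE; case: (boolP (_ \in _)) => [/set_mem[]//|_]; rewrite eqxx.
Qed.

Let trunc_int_bdd (g : R -> R) x : {homo g : x y / x <= y} ->
  (exists M, forall x, `|g x| <= M) -> bdd_meas (trunc_int g x).
Proof.
move=> gh [M gM]; have mg : measurable_fun setT g by exact: nondecreasing_measurable.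
have bg (Z : T -> R) : measurable_fun setT Z -> bdd_meas (fun w => g (x - Z w)).
  move=> mZ; split; last by exists M => w; exact: gM.
  by apply: (measurableT_comp mg); exact: measurable_funB.
apply: bdd_measM; first exact: (bdd_meas_range mchi chi01).
by apply: bdd_measD; [exact: bg|apply: bdd_measZ; exact: bg].
Qed.

(** Far to the left, displacements of size at most [K] stay where [v <= eta], so the linear lower
    bound of [G] applies; the part of the integrand cut off by truncation is nonnegative. *)
Lemma v_trunc : exists x0, forall x, x <= x0 ->
  \int[P]_w trunc_int v x w <= L * v x.
Proof.
have [y vy] := v_left eta_gt0.
exists (y - K%:R) => x xy; rewrite mulrC -ler_pdivrMr// mulrC -expectZ; last first.
  apply: trunc_int_bdd; first exact: v_mon.1.
  by exists 1 => z; rewrite ger0_norm//; have /andP[] := v_mon.2 z.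
apply: le_trans (v_super x); apply: expect_le => //.
  apply: bdd_measZ; apply: trunc_int_bdd; first exact: v_mon.1.
  by exists 1 => z; rewrite ger0_norm//; have /andP[] := v_mon.2 z.
move=> w; rewrite /integrand mulrC ler_pM2r ?invr_gt0// /trunc_int.
have a := v_ge0 (x - Z1 w); have b := v_ge0 (x - Z2 w).
have b' : 0 <= (L - 1) * v (x - Z2 w) by rewrite mulr_ge0// subr_ge0 ltW.
have g0 := G_ge0 (x - Z2 w).
have [->|/chi_Z[z1 z2]] := eqVneq (chi w) 0; first by rewrite mul0r; lra.
have h : delta * v (x - Z2 w) <= G (v (x - Z2 w)).
  apply: G_lin; apply: le_trans (ltW vy); apply: v_mon.1.
  by move: z2; rewrite ler_norml => /andP[]; lra.
have db : 0 <= delta * v (x - Z2 w) by rewrite mulr_ge0// ltW.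
have /andP[c0 c1] := chi01 w.
apply: le_trans (_ : 1 * (v (x - Z1 w) + (L - 1 + delta) * v (x - Z2 w)) <= _).
  by apply: ler_wpM2r => //; rewrite mulrDl; lra.
by rewrite mulrDl mul1r; lra.
Qed.

Let step_sum_homo eta' n : {homo step_sum v eta' n : x y / x <= y}.
Proof. by move=> x y; exact: step_sum_le. Qed.

Let step_sum_bdd eta' n : exists M, forall x, `|step_sum v eta' n x| <= M.
Proof.
exists n%:R => x; rewrite ger0_norm; last by apply: sumr_ge0.
rewrite -[n in leRHS]card_ord -sumr_const; apply: ler_sum => k _.
by have /andP[] := v_mon.2 (x - k%:R * eta').
Qed.

Lemma step_sum_trunc eta' n x0 x : 0 < eta' -> x <= x0 ->
  (forall x, x <= x0 -> \int[P]_w trunc_int v x w <= L * v x) ->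
  \int[P]_w trunc_int (step_sum v eta' n) x w <= L * step_sum v eta' n x.
Proof.
move=> e0 xx0 vH; elim: n => [|n IH].
  rewrite (_ : \int[P]_w _ = \int[P]_w (0 : R)).
    by rewrite expect_cst /step_sum big_ord0 mulr0.
  by apply: eq_Rintegral => w _; rewrite /trunc_int /step_sum !big_ord0; ring.
have step z : step_sum v eta' n.+1 z = step_sum v eta' n z + v (z - n%:R * eta').
  by rewrite /step_sum big_ord_recr.
rewrite step mulrDr.
rewrite (_ : \int[P]_w _ = \int[P]_w (trunc_int (step_sum v eta' n) x w +
    trunc_int v (x - n%:R * eta') w)); last first.
  apply: eq_Rintegral => w _; rewrite /trunc_int !step.
  have e (Z : R) : x - Z - n%:R * eta' = x - n%:R * eta' - Z by ring.
  by rewrite !e; ring.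
rewrite expectD; first apply: lerD => //.
- by apply: vH; apply: le_trans xx0; rewrite gerBl mulr_ge0// ltW.
- exact: trunc_int_bdd.
- apply: trunc_int_bdd; first exact: v_mon.1.
  by exists 1 => z; rewrite ger0_norm//; have /andP[] := v_mon.2 z.
Qed.

(** If the drift were nonpositive, [step_sum_shift] under the truncated mean would bound the surplus
    mass [A] times the grid sum by [(L + delta) * v x], up to a boundary term. With mesh
    [m.+1%:R^-1] the first [m.+1] grid points lie in [[x - 1, x]], so the grid sum is at least
    [m.+1%:R * v (x - 1)], which is unbounded in [m]. *)
Lemma drift_gt0 : (forall x, 0 < v x) -> 0 < drift K%:R.
Proof.
move=> vp; rewrite ltNge; apply/negP => D0.
have l0 : 0 <= L - 1 + delta by rewrite addr_ge0 ?subr_ge0 ?ltW.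
have [x vH] := v_trunc.
have Km := K_mass; set mass := \int[P]_w \1_(trunc_set K%:R) w in Km.
pose A := (L + delta) * mass - L.
have Ld : 0 < L + delta by rewrite addr_gt0.
have A0 : 0 < A by rewrite /A subr_gt0 mulrC -ltr_pdivrMr.
have bchi : bdd_meas chi by exact: (bdd_meas_range mchi chi01).
have bdrift := drift_bdd K%:R.
have key (m : nat) : A * (m.+1%:R * v (x - 1)) <= (L + delta) * v x.
  pose e' : R := m.+1%:R^-1.
  have e'0 : 0 < e' by rewrite /e' invr_gt0.
  (* [N] meshes make up exactly the truncation bound [K], as [step_sum_shift] requires. *)
  pose N := (m.+1 * K)%N.
  have NK : N%:R * e' = K%:R by rewrite /N natrM /e' mulrAC divff// mul1r.
  (* Left boundary term of the grid sum; it vanishes as [n] grows because [v] tends to 0 at -oo. *)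
  pose E n := N%:R * v (x - (n%:R - N%:R) * e').
  have E0 : E n @[n --> \oo] --> 0.
    rewrite -(mulr0 N%:R); apply: cvgMr; apply/cvgrPdist_le => e e0.
    have [y vy] := v_left e0.
    near=> n; rewrite sub0r normrN ger0_norm//.
    apply: le_trans (ltW vy); apply: v_mon.1.
    have : (x - y) / e' + N%:R <= n%:R by near: n; exact: nbhs_infty_ger.
    by rewrite -lerBrDr ler_pdivrMr//; lra.
  have main n : A * step_sum v e' n x <= (L + delta) * mass * (v x + E n).
    have := step_sum_trunc n e'0 (lexx x) vH.
    pose S := step_sum v e' n x.
    have low w : (L + delta) * (S - v x - E n) * chi w -
        (v x / e') * (chi w * (Z1 w + (L - 1 + delta) * Z2 w)) <=
        trunc_int (step_sum v e' n) x w.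
      rewrite /trunc_int; have [->|cw] := eqVneq (chi w) 0; first by lra.
      have /andP[c0 c1] := chi01 w.
      have [z1 z2] := chi_Z cw.
      have s1 := @step_sum_shift _ v e' v_mon e'0 n x N (Z1 w).
      have s2 := @step_sum_shift _ v e' v_mon e'0 n x N (Z2 w).
      rewrite NK in s1 s2; have {}s1 := s1 z1; have {}s2 := s2 z2.
      rewrite -/(E n) -/S in s1 s2.
      have s2' := ler_wpM2l l0 s2.
      have s := ler_wpM2l c0 (lerD s1 s2').
      apply: le_trans s; rewrite le_eqVlt; apply/orP; left; apply/eqP; ring.
    have b1 : bdd_meas (fun w => (L + delta) * (S - v x - E n) * chi w) by exact: bdd_measZ.
    have b2 : bdd_meas (fun w => v x / e' * (chi w * (Z1 w + (L - 1 + delta) * Z2 w))) by exact: bdd_measZ.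
    have low' := expect_le P (bdd_measB b1 b2)
      (trunc_int_bdd x (step_sum_homo e' n) (step_sum_bdd e' n)) low.
    move=> up; have := le_trans low' up.
    rewrite expectB// !expectZ// -/(drift K%:R) -/mass -/S /A.
    have : 0 <= v x / e' * - drift K%:R.
      by rewrite mulr_ge0 ?oppr_ge0// divr_ge0// ltW.
    lra.
  have mass1 : mass <= 1.
    have /andP[_] : 0 <= mass <= 1 by exact: expect_range.
    by [].
  have sum_ge n : (m.+1 <= n)%N -> m.+1%:R * v (x - 1) <= step_sum v e' n x.
    move=> mn; rewrite /step_sum -(big_mkord xpredT (fun k => v (x - k%:R * e'))).
    rewrite (big_cat_nat (n := m.+1))//= -[leLHS]addr0; apply: lerD; last exact: sumr_ge0.
    rewrite big_mkord -[m.+1 in leLHS]card_ord mulr_natl -sumr_const.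
    apply: ler_sum => k _; apply: v_mon.1; rewrite lerD2l lerN2 /e'.
    by rewrite ler_pdivrMr// mul1r ler_nat ltnW.
  have c1 : (L + delta) * (v x + E n) @[n --> \oo] --> (L + delta) * (v x + 0).
    by apply: cvgMr; apply: cvgD => //; exact: cvg_cst.
  rewrite addr0 in c1.
  apply: (ler_cvg_to (cvg_cst (A * (m.+1%:R * v (x - 1)) : R)) c1); near=> n.
  apply: le_trans (_ : A * step_sum v e' n x <= _).
    by rewrite ler_pM2l//; apply: sum_ge; near: n; exact: nbhs_infty_ge.
  apply: le_trans (main n) _; rewrite -mulrA ler_pM2l//.
  by rewrite -[leRHS]mul1r; apply: ler_wpM2r => //; rewrite addr_ge0// /E mulr_ge0.
near \oo => m.
have := key m; rewrite mulrCA leNgt => /negP; apply.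
rewrite -ltr_pdivrMr; last by rewrite mulr_gt0.
apply: (@lt_trans _ _ m%:R); last by rewrite ltr_nat.
by near: m; exact: nbhs_infty_gtr.
Unshelve. all: by end_near. Qed.

Lemma drift_dichotomy : 0 < drift K%:R \/
  {ae P, forall w, 0 <= Z1 w /\ 0 <= Z2 w}.
Proof.
have [vp|/existsNP[x /negP]] := pselect (forall x, 0 < v x).
  by left; exact: drift_gt0.
rewrite -leNgt => vx; right; apply: (@drift_degenerate x).
by apply/eqP; rewrite eq_le vx v_ge0.
Qed.

End Truncated.
End Drift.

Lemma trunc_setN d (T : measurableType d) (R : realType) (Z1 Z2 : T -> R) K :
  trunc_set (fun w => - Z1 w) (fun w => - Z2 w) K = trunc_set Z1 Z2 K.
Proof. by apply/seteqP; split => w; rewrite /trunc_set/= !normrN. Qed.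

Lemma driftN d (T : measurableType d) (R : realType) (P : probability T R)
    (Z1 Z2 : T -> R) (L delta K : R) :
  measurable_fun setT Z1 -> measurable_fun setT Z2 ->
  drift P (fun w => - Z1 w) (fun w => - Z2 w) L delta K =
  - drift P Z1 Z2 L delta K.
Proof.
move=> mZ1 mZ2; rewrite /drift trunc_setN -[RHS]mulN1r -expectZ; last exact: drift_bdd.
by apply: eq_Rintegral => w _; ring.
Qed.

(** * Fronts of the fixed-point problem *)

Section Operator.
Context d (T : measurableType d) (R : realType) (P : probability T R).
Variables (sg Y : T -> R) (f : R -> R) (L : R).
Hypothesis msg : measurable_fun setT sg.
Hypothesis mY : measurable_fun setT Y.
Hypothesis sg_gt0 : forall w, 0 < sg w.
Hypothesis L_gt1 : 1 < L.
Hypothesis f_lip : forall x y, `|f x - f y| <= (L - 1) * `|x - y|.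
Hypothesis f0 : f 0 = 0.
Hypothesis f1 : f 1 = 0.
Implicit Types (phi psi : R -> R) (c x : R).

(** The equation [f k = 0] becomes [react k k = k]. The share [(L - 1) * v] dominates the Lipschitz
    variation of [f], which makes [react] nondecreasing in both arguments. *)
Definition react (u v : R) := (u + ((L - 1) * v + f v)) / L.

Definition wave_op c phi x :=
  \int[P]_w react (phi (x - c * sg w - Y w)) (phi (x - c * sg w)).

Let L_gt0 : 0 < L. Proof. exact: lt_trans L_gt1. Qed.

Lemma react_le u v u' v' : u <= u' -> v <= v' -> react u v <= react u' v'.
Proof.
move=> uu vv; rewrite /react ler_pM2r ?invr_gt0// lerD//.
have := f_lip v v'; rewrite ler_norml => /andP[_].
by rewrite ler0_norm ?subr_le0//; lra.
Qed.

Lemma reactD_le u v e : 0 <= e -> react (u + e) (v + e) <= react u v + 2 * e.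
Proof.
move=> e0; rewrite /react ler_pdivrMr// [leRHS]mulrDl divfK ?gt_eqF//.
have := f_lip (v + e) v; rewrite ler_norml => /andP[_].
rewrite addrAC subrr add0r ger0_norm// => H.
have : 0 <= e * (L - 1) by rewrite mulr_ge0// subr_ge0 ltW.
nra.
Qed.

Lemma react_diag k : react k k = k + f k / L.
Proof. by rewrite /react; field; rewrite gt_eqF. Qed.

Lemma react_01 u v : 0 <= u <= 1 -> 0 <= v <= 1 -> 0 <= react u v <= 1.
Proof.
move=> /andP[u0 u1] /andP[v0 v1].
have r0 : react 0 0 = 0 by rewrite react_diag f0 mul0r addr0.
have r1 : react 1 1 = 1 by rewrite react_diag f1 mul0r addr0.
by apply/andP; split; [rewrite -r0|rewrite -r1]; exact: react_le.
Qed.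

Lemma f_cts : continuous f.
Proof.
move=> x; apply/cvgrPdist_le => e e0; near=> y.
rewrite (le_trans (f_lip _ _))// mulrC -ler_pdivlMr ?subr_gt0//.
near: y; apply: cvgr_dist_le => //; rewrite divr_gt0// subr_gt0//.
Unshelve. all: by end_near. Qed.

Lemma react_meas (U V : T -> R) : measurable_fun setT U ->
  measurable_fun setT V -> measurable_fun setT (fun w => react (U w) (V w)).
Proof.
move=> mU mV; apply: measurable_funM => //; apply: measurable_funD => //.
apply: measurable_funD; first exact: measurable_funM.
apply: measurableT_comp => //; apply: continuous_measurable_fun.
exact: f_cts.
Qed.

Lemma react_bdd_meas (U V : T -> R) : measurable_fun setT U ->
  measurable_fun setT V -> (forall w, 0 <= U w <= 1) ->
  (forall w, 0 <= V w <= 1) -> bdd_meas (fun w => react (U w) (V w)).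
Proof.
move=> mU mV U1 V1; apply: (@bdd_meas_range _ _ _ _ 0 1); first exact: react_meas.
by move=> w; exact: react_01.
Qed.

Lemma meas_arg2 phi c x : mon phi ->
  measurable_fun setT (fun w => phi (x - c * sg w)).
Proof.
move=> /mon_measurable mphi; apply: (measurableT_comp mphi).
by apply: measurable_funB => //; exact: measurable_funM.
Qed.

Lemma meas_arg1 phi c x : mon phi ->
  measurable_fun setT (fun w => phi (x - c * sg w - Y w)).
Proof.
move=> /mon_measurable mphi; apply: (measurableT_comp mphi).
by apply: measurable_funB => //; apply: measurable_funB => //; exact: measurable_funM.
Qed.

Lemma wave_op_bdd_meas phi c x : mon phi ->
  bdd_meas (fun w => react (phi (x - c * sg w - Y w)) (phi (x - c * sg w))).
Proof.
move=> mphi; apply: react_bdd_meas; [exact: meas_arg1|exact: meas_arg2| |].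
  by move=> w; exact: mphi.2.
by move=> w; exact: mphi.2.
Qed.

Lemma wave_op_le c phi psi x y : mon phi -> mon psi ->
  (forall z, phi (x + z) <= psi (y + z)) -> wave_op c phi x <= wave_op c psi y.
Proof.
move=> mphi mpsi pp; apply: expect_le; [exact: wave_op_bdd_meas..|] => w.
by apply: react_le; [rewrite -!addrA|]; exact: pp.
Qed.

Lemma wave_op_mon c phi : mon phi -> mon (wave_op c phi).
Proof.
move=> mphi; split => [x y xy|x].
  by apply: wave_op_le => // z; apply: mphi.1; rewrite lerD2r.
apply: expect_range; first exact: wave_op_bdd_meas.
by move=> w; apply: react_01; exact: mphi.2.
Qed.

Lemma wave_op_shift c phi a x :
  wave_op c (fun z => phi (z + a)) x = wave_op c phi (x + a).
Proof.
apply: eq_Rintegral => w _.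
rewrite /= (_ : x - c * sg w - Y w + a = x + a - c * sg w - Y w); last by ring.
by rewrite (_ : x - c * sg w + a = x + a - c * sg w)//; ring.
Qed.

(** Since [sg] is positive, a larger [c] evaluates the profile further to the left. *)
Lemma wave_op_nincr c c' phi x : mon phi -> c <= c' ->
  wave_op c' phi x <= wave_op c phi x.
Proof.
move=> mphi cc; apply: expect_le; [exact: wave_op_bdd_meas..|] => w.
have H : x - c' * sg w <= x - c * sg w.
  by rewrite lerD2l lerN2 ler_pM2r.
by apply: react_le; apply: mphi.1 => //; rewrite lerD2r.
Qed.

Lemma wave_op_limsup (phi_ : nat -> R -> R) (c_ x_ a_ : nat -> R)
    (U V : T -> R) (a : R) :
  (forall n, mon (phi_ n)) -> measurable_fun setT U -> measurable_fun setT V ->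
  (forall w, 0 <= U w <= 1) -> (forall w, 0 <= V w <= 1) ->
  (forall w e, 0 < e -> \forall n \near \oo,
    phi_ n (x_ n - c_ n * sg w - Y w) <= U w + e) ->
  (forall w e, 0 < e -> \forall n \near \oo,
    phi_ n (x_ n - c_ n * sg w) <= V w + e) ->
  (\forall n \near \oo, a_ n <= wave_op (c_ n) (phi_ n) (x_ n)) ->
  a_ n @[n --> \oo] --> a ->
  a <= \int[P]_w react (U w) (V w).
Proof.
move=> mphi mU mV U1 V1 phiU phiV ag ca.
have nr (r : R) : 0 <= r <= 1 -> `|r| <= 1 by move=> /andP[r0 r1]; rewrite ger0_norm.
apply: (expect_limsup_le (M := 1) _ _ _ _ _ ag ca).
- by move=> n; apply: react_meas; [exact: meas_arg1|exact: meas_arg2].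
- exact: react_meas.
- by move=> n w; apply: nr; apply: react_01; exact: (mphi n).2.
- by move=> w; apply: nr; exact: react_01.
move=> w e e0; have e2 : 0 < e / 2 by lra.
near=> n; rewrite (le_trans (y := react (U w + e / 2) (V w + e / 2)))//.
  by apply: react_le; near: n; [exact: phiU|exact: phiV].
by rewrite (le_trans (reactD_le _ _ (ltW e2)))//; lra.
Unshelve. all: by end_near. Qed.

Lemma wave_op_liminf (phi_ : nat -> R -> R) (c_ x_ a_ : nat -> R)
    (U V : T -> R) (a : R) :
  (forall n, mon (phi_ n)) -> measurable_fun setT U -> measurable_fun setT V ->
  (forall w, 0 <= U w <= 1) -> (forall w, 0 <= V w <= 1) ->
  (forall w e, 0 < e -> \forall n \near \oo,
    U w - e <= phi_ n (x_ n - c_ n * sg w - Y w)) ->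
  (forall w e, 0 < e -> \forall n \near \oo,
    V w - e <= phi_ n (x_ n - c_ n * sg w)) ->
  (\forall n \near \oo, wave_op (c_ n) (phi_ n) (x_ n) <= a_ n) ->
  a_ n @[n --> \oo] --> a ->
  \int[P]_w react (U w) (V w) <= a.
Proof.
move=> mphi mU mV U1 V1 phiU phiV ag ca.
have nr (r : R) : 0 <= r <= 1 -> `|- 1 * r| <= 1.
  by rewrite mulN1r normrN => /andP[r0 r1]; rewrite ger0_norm.
rewrite -lerN2 -[leRHS]mulN1r -expectZ; last exact: react_bdd_meas.
apply: (expect_limsup_le (M := 1) (a_ := fun n => - a_ n)
  (g_ := fun n w => -1 * react (phi_ n (x_ n - c_ n * sg w - Y w)) (phi_ n (x_ n - c_ n * sg w)))).
- move=> n; apply: measurable_funM => //.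
  by apply: react_meas; [exact: meas_arg1|exact: meas_arg2].
- by apply: measurable_funM => //; exact: react_meas.
- by move=> n w; apply: nr; apply: react_01; exact: (mphi n).2.
- by move=> w; apply: nr; exact: react_01.
- move=> w e e0; have e2 : 0 < e / 2 by lra.
  near=> n; have : react (U w) (V w) <=
      react (phi_ n (x_ n - c_ n * sg w - Y w)) (phi_ n (x_ n - c_ n * sg w)) + 2 * (e / 2).
    apply: le_trans (reactD_le _ _ (ltW e2)).
    by apply: react_le; rewrite -lerBlDr; near: n; [exact: phiU|exact: phiV].
  lra.
- apply: filterS ag => n ag; rewrite expectZ ?mulN1r ?lerN2//.
  exact: wave_op_bdd_meas.
- exact: cvgN.
Unshelve. all: by end_near. Qed.

(** * Passage of the wave inequalities to Helly limits *)

Section LimitProfile.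
Variables (phi_ : nat -> R -> R) (chi : R -> R) (c_ : nat -> R) (c : R).
Hypothesis phi_chi : mon_cvg phi_ chi.
Hypothesis c_c : c_ n @[n --> \oo] --> c.

Let mchi : mon chi. Proof. by case: phi_chi. Qed.

Let arg_cvg y w : y - c_ n * sg w @[n --> \oo] --> y - c * sg w.
Proof. by apply: cvgB; [exact: cvg_cst|apply: cvgMl]. Qed.

(** Convergence is controlled only up to a small move of the point. So [chi x] is first compared
    with the operator at [y] slightly to the right of [x]; then [y] decreases to [x] and
    right-continuity of [chi] concludes. *)
Lemma limit_sub x x' : x < x' ->
  (forall y, x < y < x' -> \forall n \near \oo, phi_ n y <= wave_op (c_ n) (phi_ n) y) ->
  chi x <= wave_op c chi x.
Proof.
move=> xx' sub; have [mphi _ H1 H2] := phi_chi.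
have step y : x < y < x' -> chi x <= wave_op c chi y.
  move=> xyx'; have /andP[xy yx'] := xyx'.
  apply/ler_addgt0Pr => e e0; rewrite -lerBlDr.
  have H z w e' : 0 < e' -> \forall n \near \oo,
      phi_ n (y - c_ n * sg w - z) <= chi (y - c * sg w - z) + e'.
    move=> e'0; have [t zt Ht] := H1 (y - c * sg w - z) e' e'0.
    have cz : y - c_ n * sg w - z @[n --> \oo] --> y - c * sg w - z.
      by apply: cvgB => //; exact: cvg_cst.
    have Hz : \forall n \near \oo, y - c_ n * sg w - z <= t by apply: (cvgr_le _ cz).
    near=> n; rewrite (le_trans (y := phi_ n t))//; last by near: n.
    by apply: (mphi n).1; near: n.
  apply: (wave_op_limsup (phi_ := phi_) (c_ := c_) (x_ := fun=> y)
    (a_ := fun=> chi x - e)) => //.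
  - exact: meas_arg1.
  - exact: meas_arg2.
  - by move=> w; exact: mchi.2.
  - by move=> w; exact: mchi.2.
  - by move=> w; exact: H.
  - by move=> w e' e'0; have := H 0 w e' e'0; under eq_near do rewrite subr0; rewrite subr0.
  - near=> n; rewrite (le_trans (y := phi_ n y))//; first by near: n; exact: H2.
    by near: n; exact: sub.
  - exact: cvg_cst.
pose y_ n := x + (x' - x) / 2 * n.+1%:R^-1.
have y_x : y_ n @[n --> \oo] --> x.
  rewrite -[X in _ --> X]addr0 -[X in _ --> _ + X](mulr0 ((x' - x) / 2)).
  by apply: cvgD; [exact: cvg_cst|apply: cvgMr; exact: cvg_harmonic].
have y_I n : x < y_ n < x'.
  have n0 : 0 < (n.+1%:R : R)^-1 by rewrite invr_gt0.
  have n1 : (n.+1%:R : R)^-1 <= 1 by rewrite invf_le1 ?ler1n.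
  have d0 : 0 < (x' - x) / 2 by lra.
  have := mulr_gt0 d0 n0; have := ler_piMr (ltW d0) n1.
  by rewrite /y_; set t := _ / n.+1%:R => A B; apply/andP; split; lra.
have H z w e' : 0 < e' -> \forall n \near \oo,
    chi (y_ n - c * sg w - z) <= chi (x - c * sg w - z) + e'.
  move=> e'0; have [t zt Ht] := mon_cvg_rcts phi_chi (x - c * sg w - z) e'0.
  have cz : y_ n - c * sg w - z @[n --> \oo] --> x - c * sg w - z.
    by apply: cvgB; [apply: cvgB => //|]; exact: cvg_cst.
  have Hz : \forall n \near \oo, y_ n - c * sg w - z <= t by apply: (cvgr_le _ cz).
  near=> n; rewrite (le_trans (y := chi t))//.
  by apply: mchi.1; near: n.
apply: (wave_op_limsup (phi_ := fun=> chi) (c_ := fun=> c) (x_ := y_)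
  (a_ := fun=> chi x)) => //.
- exact: meas_arg1.
- exact: meas_arg2.
- by move=> w; exact: mchi.2.
- by move=> w; exact: mchi.2.
- by move=> w; exact: H.
- by move=> w e' e'0; have := H 0 w e' e'0; under eq_near do rewrite subr0; rewrite subr0.
- by apply: nearW => n; exact: step.
- exact: cvg_cst.
Unshelve. all: by end_near. Qed.

(** Here one auxiliary point [y] to the right of [x] suffices: [phi_ n y] is controlled by
    [phi_ n t] with [y <= t], and in the limit the operator at [y] dominates the operator on [chi]
    at [x]. *)
Lemma limit_super x x' : x < x' ->
  (forall y, x < y < x' -> \forall n \near \oo, wave_op (c_ n) (phi_ n) y <= phi_ n y) ->
  wave_op c chi x <= chi x.
Proof.
move=> xx' super; have [mphi _ H1 H2] := phi_chi.
apply/ler_addgt0Pr => e e0.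
have [t xt Ht] := H1 x e e0.
pose y := Num.min t ((x + x') / 2).
have xy : x < y by rewrite lt_min xt; lra.
have yt : y <= t by rewrite ge_min lexx.
have yx' : y < x' by rewrite gt_min; apply/orP; right; lra.
have H z w e' : 0 < e' -> \forall n \near \oo,
    chi (x - c * sg w - z) - e' <= phi_ n (y - c_ n * sg w - z).
  move=> e'0; pose m := ((x + y) / 2 - c * sg w - z).
  have cz : y - c_ n * sg w - z @[n --> \oo] --> y - c * sg w - z.
    by apply: cvgB => //; exact: cvg_cst.
  have my : m < y - c * sg w - z by rewrite /m; lra.
  have Hz : \forall n \near \oo, m <= y - c_ n * sg w - z by apply: (cvgr_ge _ cz).
  near=> n; rewrite (le_trans (y := phi_ n m))//.
    by near: n; apply: H2 => //; rewrite /m; lra.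
  by apply: (mphi n).1; near: n.
apply: (wave_op_liminf (phi_ := phi_) (c_ := c_) (x_ := fun=> y)
    (a_ := fun=> chi x + e)) => //.
- exact: meas_arg1.
- exact: meas_arg2.
- by move=> w; exact: mchi.2.
- by move=> w; exact: mchi.2.
- by move=> w; exact: H.
- by move=> w e' e'0; have := H 0 w e' e'0; under eq_near do rewrite !subr0.
- near=> n; rewrite (le_trans (y := phi_ n y))//.
    by near: n; apply: super; rewrite xy.
  by rewrite (le_trans (y := phi_ n t))//; [apply: (mphi n).1|near: n].
- exact: cvg_cst.
Unshelve. all: by end_near. Qed.

End LimitProfile.

Definition sub_wave c phi := forall x, phi x <= wave_op c phi x.
Definition super_wave c phi := forall x, wave_op c phi x <= phi x.

Lemma wave_between c lo hi : mon lo -> mon hi -> sub_wave c lo ->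
  super_wave c hi -> (forall x, lo x <= hi x) ->
  exists phi, [/\ mon phi, forall x, wave_op c phi x = phi x,
    forall x, lo x <= phi x & forall x, phi x <= hi x].
Proof.
move=> mlo mhi slo shi lohi; apply: mon_tarski => //.
- exact: wave_op_mon.
- by move=> phi psi mphi mpsi pp x; apply: wave_op_le.
Qed.

Definition truncated_wave c h phi :=
  [/\ mon phi, forall x, x < 0 -> phi x = 0, forall x, h <= x -> phi x = 1 &
    forall x, 0 <= x < h -> phi x = wave_op c phi x].

Lemma truncated_wave_exists c h : 0 <= h -> exists phi, truncated_wave c h phi.
Proof.
move=> h0.
pose F phi x := if x < 0 then 0 else if x < h then wave_op c phi x else 1.
have Fm phi : mon phi -> mon (F phi).
  move=> mphi; have [wm w01] := wave_op_mon c mphi.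
  have F01 x : 0 <= F phi x <= 1.
    by rewrite /F; case: ifP => _; [|case: ifP => _]; rewrite ?w01 ?lexx ?ler01.
  split=> // x y xy.
  have /andP[_ wx1] := w01 x.
  case: (boolP (x < 0)) => x0.
    by rewrite {1}/F x0; have /andP[] := F01 y.
  rewrite /F (negbTE x0).
  have -> : (y < 0) = false by apply/negbTE; rewrite -leNgt (le_trans _ xy)// leNgt.
  case: ifP => xh; first by case: ifP => // _; exact: wm.
  by rewrite ifF//; apply/negbTE; rewrite -leNgt (le_trans _ xy)// leNgt xh.
have [||||||phi [mphi phiF _ _]] := @mon_tarski R F (fun=> 0) (fun=> 1) Fm.
- move=> phi psi mphi mpsi pp x; rewrite /F; case: ifP => // _; case: ifP => // _.
  exact: wave_op_le.
- by apply: mon_cst; rewrite lexx ler01.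
- by apply: mon_cst; rewrite lexx ler01.
- move=> x; have mm : mon (fun=> 0 : R) by apply: mon_cst; rewrite lexx ler01.
  by have /andP[] := (Fm _ mm).2 x.
- move=> x; have mm : mon (fun=> 1 : R) by apply: mon_cst; rewrite lexx ler01.
  by have /andP[] := (Fm _ mm).2 x.
- by [].
exists phi; split => //.
- by move=> x x0; rewrite -phiF /F x0.
- move=> x hx; rewrite -phiF /F ltNge (le_trans h0 hx)/= ltNge hx//.
- by move=> x /andP[x0 xh]; rewrite -{1}phiF /F ltNge x0/= xh.
Qed.

(** The imposed values 0 and 1 are the extreme ones, so the equation inside the window extends as an
    inequality: this one to the left, [truncated_super] to the right. *)
Lemma truncated_sub c h phi x : truncated_wave c h phi -> x < h ->
  phi x <= wave_op c phi x.
Proof.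
move=> [mphi p0 p1 pw] xh; have [x0|x0] := ltP x 0.
  by rewrite p0//; have /andP[] := (wave_op_mon c mphi).2 x.
by rewrite -pw// x0.
Qed.

Lemma truncated_super c h phi x : truncated_wave c h phi -> 0 <= x ->
  wave_op c phi x <= phi x.
Proof.
move=> [mphi p0 p1 pw] x0; have [hx|xh] := leP h x.
  by rewrite (p1 x)//; have /andP[] := (wave_op_mon c mphi).2 x.
by rewrite -pw// x0.
Qed.

(** * Values of sub- and supersolutions at infinity *)

Section Limits.
Variables (c : R) (phi : R -> R) (k : R).
Hypotheses (mphi : mon phi) (k01 : 0 <= k <= 1).

Let react_cst : \int[P]_w react k k = react k k. Proof. exact: expect_cst. Qed.

Lemma near_left_limit (r e : R) : left_limit phi k -> 0 < e ->
  \forall n \near \oo, phi (- n%:R - r) <= k + e.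
Proof.
move=> [_ kx] e0; have [x xk] := kx e e0.
near=> n; rewrite (le_trans _ (ltW xk))//; apply: mphi.1.
rewrite lerBlDr lerNl; near: n; exact: nbhs_infty_ger.
Unshelve. all: by end_near. Qed.

Lemma near_right_limit (r e : R) : right_limit phi k -> 0 < e ->
  \forall n \near \oo, k - e <= phi (n%:R - r).
Proof.
move=> [_ kx] e0; have [x xk] := kx e e0.
near=> n; rewrite (le_trans (ltW xk))//; apply: mphi.1.
rewrite lerBrDr; near: n; exact: nbhs_infty_ger.
Unshelve. all: by end_near. Qed.

(** Evaluated at [- n%:R], the inequality tends to the one for the constant [k]; by [react_diag] it
    fixes the sign of [f k]. *)
Lemma sub_left_limit : left_limit phi k -> sub_wave c phi -> k <= react k k.
Proof.
move=> kl sphi; rewrite -react_cst.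
apply: (wave_op_limsup (phi_ := fun=> phi) (c_ := fun=> c)
  (x_ := fun n => - n%:R) (a_ := fun=> k)) => //.
- by move=> w e e0; have := near_left_limit (c * sg w + Y w) kl e0;
    apply: filterS => n; rewrite opprD addrA.
- by move=> w e e0; exact: near_left_limit.
- by apply: nearW => n; apply: le_trans (kl.1 _) (sphi _).
- exact: cvg_cst.
Qed.

Lemma super_left_limit : left_limit phi k -> super_wave c phi -> react k k <= k.
Proof.
move=> kl sphi; rewrite -react_cst.
apply/ler_addgt0Pr => e e0.
apply: (wave_op_liminf (phi_ := fun=> phi) (c_ := fun=> c)
  (x_ := fun n => - n%:R) (a_ := fun=> k + e)) => //.
- move=> w e' e'0; apply: nearW => n; apply: le_trans (kl.1 _).
  by rewrite gerBl ltW.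
- move=> w e' e'0; apply: nearW => n; apply: le_trans (kl.1 _).
  by rewrite gerBl ltW.
- have := near_left_limit 0 kl e0; apply: filterS => n; rewrite subr0.
  exact: le_trans.
- exact: cvg_cst.
Qed.

Lemma super_right_limit : right_limit phi k -> super_wave c phi -> react k k <= k.
Proof.
move=> kl sphi; rewrite -react_cst.
apply: (wave_op_liminf (phi_ := fun=> phi) (c_ := fun=> c)
  (x_ := fun n => n%:R) (a_ := fun=> k)) => //.
- by move=> w e e0; have := near_right_limit (c * sg w + Y w) kl e0;
    apply: filterS => n; rewrite opprD addrA.
- by move=> w e e0; exact: near_right_limit.
- by apply: nearW => n; apply: le_trans (sphi _) (kl.1 _).
- exact: cvg_cst.
Qed.

Lemma sub_right_limit : right_limit phi k -> sub_wave c phi -> k <= react k k.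
Proof.
move=> kl sphi; rewrite -react_cst.
apply/ler_addgt0Pr => e e0; rewrite -lerBlDr.
apply: (wave_op_limsup (phi_ := fun=> phi) (c_ := fun=> c)
  (x_ := fun n => n%:R) (a_ := fun=> k - e)) => //.
- move=> w e' e'0; apply: nearW => n; apply: le_trans (kl.1 _) _.
  by rewrite lerDl ltW.
- move=> w e' e'0; apply: nearW => n; apply: le_trans (kl.1 _) _.
  by rewrite lerDl ltW.
- have := near_right_limit 0 kl e0; apply: filterS => n; rewrite subr0.
  by move/le_trans; apply.
- exact: cvg_cst.
Qed.

(** As the speed tends to +oo, positivity of [sg] sends both arguments of [react] to values of the
    profile near -oo, which are close to [k]. *)
Lemma sub_all_speeds x : left_limit phi k ->
  (forall n : nat, phi x <= wave_op n%:R phi x) -> phi x <= react k k.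
Proof.
move=> kl sphi; rewrite -react_cst.
have H r w e : 0 < e -> \forall n \near \oo, phi (x - n%:R * sg w - r) <= k + e.
  move=> e0; have [z zk] := kl.2 e e0.
  near=> n; rewrite (le_trans _ (ltW zk))//; apply: mphi.1.
  have : (x - r - z) / sg w <= n%:R by near: n; exact: nbhs_infty_ger.
  by rewrite ler_pdivrMr//; lra.
apply: (wave_op_limsup (phi_ := fun=> phi) (c_ := fun n => n%:R)
  (x_ := fun=> x) (a_ := fun=> phi x)) => //.
- by move=> w e e0; exact: H.
- by move=> w e e0; have := H 0 w e e0; apply: filterS => n; rewrite subr0.
- exact: nearW.
- exact: cvg_cst.
Unshelve. all: by end_near. Qed.

Lemma super_all_speeds x : right_limit phi k ->
  (forall n : nat, wave_op (- n%:R) phi x <= phi x) -> react k k <= phi x.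
Proof.
move=> kl sphi; rewrite -react_cst.
have H r w e : 0 < e -> \forall n \near \oo, k - e <= phi (x - - n%:R * sg w - r).
  move=> e0; have [z zk] := kl.2 e e0.
  near=> n; rewrite (le_trans (ltW zk))//; apply: mphi.1.
  have : (z + r - x) / sg w <= n%:R by near: n; exact: nbhs_infty_ger.
  by rewrite ler_pdivrMr//; lra.
apply: (wave_op_liminf (phi_ := fun=> phi) (c_ := fun n => - n%:R)
  (x_ := fun=> x) (a_ := fun=> phi x)) => //.
- by move=> w e e0; exact: H.
- by move=> w e e0; have := H 0 w e e0; apply: filterS => n; rewrite subr0.
- exact: nearW.
- exact: cvg_cst.
Unshelve. all: by end_near. Qed.

End Limits.

(** * Helly limits of truncated waves recentred at a level *)

Section Profile.
Variables (c_ h_ : nat -> R) (phi_ : nat -> R -> R) (y_ : nat -> R) (lev : R).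
Hypothesis tr : forall n, truncated_wave (c_ n) (h_ n) (phi_ n).
Hypothesis h_oo : forall M, \forall n \near \oo, M <= h_ n.
Hypothesis y_itv : forall n, 0 <= y_ n <= h_ n.
Hypothesis y_lt : forall n x, x < y_ n -> phi_ n x < lev.
Hypothesis y_gt : forall n x, y_ n < x -> lev <= phi_ n x.

Let mphi n : mon (phi_ n). Proof. by case: (tr n). Qed.

(* [y_ n] is the position of the level [lev]; it is either bounded along the
   subsequence, or far from the left end [0] of the window, and likewise for
   the right end [h_ n]. *)
Lemma profile_subseq : exists s chi, [/\ {homo s : m n / (m < n)%N},
  mon_cvg (fun n x => phi_ (s n) (x + y_ (s n))) chi,
  (forall x, x < 0 -> chi x <= lev) /\ (forall x, 0 <= x -> lev <= chi x),
  (forall M, \forall n \near \oo, M <= y_ (s n)) \/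
    (exists M, \forall n \near \oo, y_ (s n) <= M) &
  (forall M, \forall n \near \oo, M <= h_ (s n) - y_ (s n)) \/
    (exists M, \forall n \near \oo, h_ (s n) - y_ (s n) <= M)].
Proof.
have y0 n : 0 <= y_ n by have /andP[] := y_itv n.
have hy0 n : 0 <= h_ n - y_ n by have /andP[_] := y_itv n; rewrite subr_ge0.
have inv01 (r : R) : 0 <= r -> 0 <= (1 + r)^-1 <= 1.
  move=> r0; rewrite invr_ge0 addr_ge0//= invf_le1 ?ltr_pwDl//.
  by rewrite lerDl.
pose u k n := if k is 0%N then (1 + y_ n)^-1 else (1 + (h_ n - y_ n))^-1.
have [|k n|s [chi [hs cu cchi]]] := helly (phi_ := fun n x => phi_ n (x + y_ n)) (u := u).
- by move=> n; exact: mon_shift.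
- by case: k => [|k]; exact: inv01.
have [_ mchi H1 H2] := cchi.
exists s, chi; split => //.
- split=> x x0.
    apply/ler_addgt0Pr => e e0; rewrite -lerBlDr.
    have x2 : x < x / 2 by lra.
    near \oo => n.
    apply: (@le_trans _ _ (phi_ (s n) (x / 2 + y_ (s n)))).
      by near: n; exact: H2.
    by apply/ltW/y_lt; lra.
  apply/ler_addgt0Pr => e e0; have [y xy Hy] := H1 x e e0.
  near \oo => n.
  apply: (@le_trans _ _ (phi_ (s n) (y + y_ (s n)))); last by near: n.
  by apply: y_gt; rewrite ltrDr; exact: le_lt_trans xy.
- by have [l cl] := cu 0%N; exact: (cvg_inv_dichotomy _ cl).
- by have [l cl] := cu 1%N; exact: (cvg_inv_dichotomy _ cl).
Unshelve. all: by end_near. Qed.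

Variables (s : nat -> nat) (chi : R -> R).
Hypothesis hs : {homo s : m n / (m < n)%N}.
Hypothesis cchi : mon_cvg (fun n x => phi_ (s n) (x + y_ (s n))) chi.

Let hs_oo M : \forall n \near \oo, M <= h_ (s n).
Proof. exact: (subseq_infty hs (h_oo M)). Qed.

Lemma profile_left_zero M : (\forall n \near \oo, y_ (s n) <= M) ->
  forall x, x < - M -> chi x = 0.
Proof.
have [_ mchi H1 H2] := cchi.
move=> yM x xM; apply/eqP; rewrite eq_le; have /andP[-> _] := mchi.2 x.
rewrite andbT; apply/ler_addgt0Pr => e e0; rewrite -lerBlDr.
have xx : x < (x - M) / 2 by lra.
near \oo => n.
apply: (@le_trans _ _ (phi_ (s n) ((x - M) / 2 + y_ (s n)))).
  by near: n; exact: H2.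
have [_ p0 _ _] := tr (s n); rewrite p0//.
have : y_ (s n) <= M by near: n.
lra.
Unshelve. all: by end_near. Qed.

Lemma profile_right_one M : (\forall n \near \oo, h_ (s n) - y_ (s n) <= M) ->
  forall x, M <= x -> chi x = 1.
Proof.
have [_ mchi H1 H2] := cchi.
move=> yM x xM; apply/eqP; rewrite eq_le; have /andP[_ ->] := mchi.2 x => /=.
apply/ler_addgt0Pr => e e0; have [y xy Hy] := H1 x e e0.
near \oo => n.
apply: (@le_trans _ _ (phi_ (s n) (y + y_ (s n)))); last by near: n.
have [_ _ p1 _] := tr (s n); rewrite p1//.
have : h_ (s n) - y_ (s n) <= M by near: n.
lra.
Unshelve. all: by end_near. Qed.

Lemma profile_mid_le a M : (forall n, phi_ n (h_ n / 2) < a) ->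
  (\forall n \near \oo, y_ (s n) <= M) -> forall x, chi x <= a.
Proof.
have [_ mchi H1 H2] := cchi.
move=> mid yM x; apply/ler_addgt0Pr => e e0; rewrite -lerBlDr.
have xx : x < x + 1 by lra.
near \oo => n.
apply: (@le_trans _ _ (phi_ (s n) (x + 1 + y_ (s n)))).
  by near: n; exact: H2.
apply: le_trans (ltW (mid (s n))); apply: (mphi _).1.
have : y_ (s n) <= M by near: n.
have : 2 * (x + 1 + M) <= h_ (s n) by near: n; exact: hs_oo.
lra.
Unshelve. all: by end_near. Qed.

Lemma profile_mid_ge a M : (forall n, a <= phi_ n (h_ n / 2)) ->
  (\forall n \near \oo, h_ (s n) - y_ (s n) <= M) -> forall x, a <= chi x.
Proof.
have [_ mchi H1 H2] := cchi.
move=> mid yM x; apply/ler_addgt0Pr => e e0; have [y xy Hy] := H1 x e e0.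
near \oo => n.
apply: (@le_trans _ _ (phi_ (s n) (y + y_ (s n)))); last by near: n.
apply: le_trans (mid (s n)) _; apply: (mphi _).1.
have : h_ (s n) - y_ (s n) <= M by near: n.
have : 2 * (M - x) <= h_ (s n) by near: n; exact: hs_oo.
lra.
Unshelve. all: by end_near. Qed.

(** The operator decreases in the speed, so a convergent lower bound [b_] of the speeds suffices;
    this also covers speeds that tend to +oo. *)
Lemma profile_sub (b_ : nat -> R) b :
  b_ n @[n --> \oo] --> b -> (\forall n \near \oo, b_ n <= c_ (s n)) ->
  (forall M, \forall n \near \oo, M <= h_ (s n) - y_ (s n)) -> sub_wave b chi.
Proof.
move=> bb bc hy x; have xx : x < x + 1 by lra.
apply: (limit_sub cchi bb xx) => y /andP[_ yx].
near=> n; rewrite wave_op_shift.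
apply: (@le_trans _ _ (wave_op (c_ (s n)) (phi_ (s n)) (y + y_ (s n)))); last first.
  by apply: wave_op_nincr => //; near: n; exact: bc.
apply: truncated_sub (tr _) _.
have : x + 1 <= h_ (s n) - y_ (s n) by near: n; exact: hy.
lra.
Unshelve. all: by end_near. Qed.

Lemma profile_super (b_ : nat -> R) b :
  b_ n @[n --> \oo] --> b -> (\forall n \near \oo, c_ (s n) <= b_ n) ->
  (forall M, \forall n \near \oo, M <= y_ (s n)) -> super_wave b chi.
Proof.
move=> bb bc hy x; have xx : x < x + 1 by lra.
apply: (limit_super cchi bb xx) => y /andP[xy _].
near=> n; rewrite wave_op_shift.
apply: (@le_trans _ _ (wave_op (c_ (s n)) (phi_ (s n)) (y + y_ (s n)))).
  by apply: wave_op_nincr => //; near: n; exact: bc.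
apply: truncated_super (tr _) _.
have : - x <= y_ (s n) by near: n; exact: hy.
lra.
Unshelve. all: by end_near. Qed.

End Profile.

Lemma truncated_crossing c h phi lev : truncated_wave c h phi -> 0 <= h ->
  0 < lev <= 1 ->
  exists y, [/\ 0 <= y <= h, forall x, x < y -> phi x < lev &
    forall x, y < x -> lev <= phi x].
Proof.
move=> [mphi p0 p1 _] h0 /andP[l0 l1].
have pm : phi (- 1) < lev by rewrite p0 ?ltrN10.
have ph : lev <= phi h by rewrite p1.
have [y [/andP[_ yh] ylt ygt]] := mon_crossing mphi.1 pm ph.
exists y; split => //; rewrite yh andbT leNgt; apply/negP => y0.
have : lev <= phi (y / 2) by apply: ygt; lra.
by rewrite p0 ?leNgt ?l0//; lra.
Qed.

Lemma truncated_crossings (c_ h_ : nat -> R) (phi_ : nat -> R -> R) lev :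
  (forall n, truncated_wave (c_ n) (h_ n) (phi_ n)) -> (forall n, 0 <= h_ n) ->
  0 < lev <= 1 -> exists y_ : nat -> R, [/\ forall n, 0 <= y_ n <= h_ n,
  forall n x, x < y_ n -> phi_ n x < lev &
  forall n x, y_ n < x -> lev <= phi_ n x].
Proof.
move=> tr h0 l01.
have H n := truncated_crossing (tr n) (h0 n) l01.
exists (fun n => sval (cid (H n))).
by split=> n; case: (svalP (cid (H n))).
Qed.

(** * Kinds of limit profiles for the bistable nonlinearity *)

Variable alpha : R.
Hypothesis alpha_itv : 0 < alpha < 1.
Hypothesis falpha : f alpha = 0.
Hypothesis f_lt0 : forall x, 0 < x < alpha -> f x < 0.
Hypothesis f_gt0 : forall x, alpha < x < 1 -> 0 < f x.

Lemma le_react k : 0 <= k <= 1 -> k <= react k k -> k = 0 \/ alpha <= k.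
Proof.
move=> /andP[k0 k1]; rewrite react_diag lerDl => fk.
have [ak|ka] := leP alpha k; [by right|left].
apply/eqP; rewrite eq_le k0 andbT leNgt; apply/negP => k0'.
move: fk; rewrite leNgt pmulr_llt0 ?invr_gt0// f_lt0//.
by rewrite k0'.
Qed.

Lemma ge_react k : 0 <= k <= 1 -> react k k <= k -> k <= alpha \/ k = 1.
Proof.
move=> /andP[k0 k1]; rewrite react_diag gerDl => fk.
have [ka|ak] := leP k alpha; [by left|right].
apply/eqP; rewrite eq_le k1/= leNgt; apply/negP => k1'.
move: fk; rewrite leNgt pmulr_lgt0 ?invr_gt0// f_gt0//.
by rewrite ak.
Qed.

Definition front c := exists phi, [/\ mon phi,
  forall x, wave_op c phi x = phi x, left_limit phi 0 & right_limit phi 1].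

(** Monostable profile below [alpha], reduced to what the drift argument uses: one inequality, the
    limit [alpha] and non-triviality. *)
Definition lower_sub_front c := exists phi, [/\ mon phi, sub_wave c phi,
  right_limit phi alpha & exists x, phi x < alpha].

Definition upper_super_front c := exists phi, [/\ mon phi, super_wave c phi,
  left_limit phi alpha & exists x, alpha < phi x].

Definition half_sub_front c := exists phi, [/\ mon phi, sub_wave c phi,
  exists M, forall x, x < M -> phi x = 0 & exists x, alpha < phi x].

Definition half_super_front c := exists phi, [/\ mon phi, super_wave c phi,
  exists M, forall x, M <= x -> phi x = 1 & exists x, phi x < alpha].

Lemma fixed_front c phi : mon phi -> (forall x, wave_op c phi x = phi x) ->
  (exists x, phi x < alpha) -> (exists x, alpha < phi x) -> front c.
Proof.
move=> mphi fix_phi [x xa] [y ya].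
have sphi : sub_wave c phi by move=> z; rewrite fix_phi.
have Sphi : super_wave c phi by move=> z; rewrite fix_phi.
have [k k01 kl] := mon_left_limit mphi.
have [k' k'01 kr] := mon_right_limit mphi.
exists phi; split => //.
  have [<-//|ak] := le_react k01 (sub_left_limit mphi k01 kl sphi).
  by have := le_lt_trans (kl.1 x) xa; rewrite ltNge ak.
have [ka|<-//] := ge_react k'01 (super_right_limit mphi k'01 kr Sphi).
by have := lt_le_trans ya (kr.1 y); rewrite ltNge ka.
Qed.

Lemma half_fronts_front c : half_sub_front c -> half_super_front c -> front c.
Proof.
move=> [lo [mlo slo [M loM] [x xa]]] [hi [mhi shi [N hiN] [y ya]]].
(* The shifted [lo] vanishes to the left of [N], and [hi] equals 1 from [N] on, so the two are
   ordered. *)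
pose a := M - N.
have mlo' : mon (fun z => lo (z + a)) by exact: mon_shift.
have slo' : sub_wave c (fun z => lo (z + a)).
  by move=> z; rewrite wave_op_shift.
have lohi z : lo (z + a) <= hi z.
  have [zN|Nz] := ltP z N.
    by rewrite loM; [have /andP[] := mhi.2 z|rewrite /a; lra].
  by rewrite hiN//; have /andP[] := mlo.2 (z + a).
have [phi [mphi fix_phi lophi phihi]] := wave_between mlo' mhi slo' shi lohi.
apply: (fixed_front mphi fix_phi).
  by exists y; exact: le_lt_trans ya.
exists (x - a); apply: lt_le_trans xa _.
by have := lophi (x - a); rewrite subrK.
Qed.

Section LimitCases.
Variables (c : R) (chi : R -> R) (lev : R).
Hypothesis mchi : mon chi.
Hypothesis chi_lt : forall x, x < 0 -> chi x <= lev.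
Hypothesis chi_ge : forall x, 0 <= x -> lev <= chi x.

(** The limit at +oo is at least [lev], hence positive, hence at least [alpha] by [le_react]; the
    two alternatives are equality and strict inequality. *)
Lemma sub_low : 0 < lev < alpha -> sub_wave c chi ->
  lower_sub_front c \/ exists x, alpha < chi x.
Proof.
move=> /andP[l0 la] schi.
have [k k01 kr] := mon_right_limit mchi.
have lk : lev <= k by apply: le_trans (kr.1 0); exact: chi_ge.
have [k0|ak] := le_react k01 (sub_right_limit mchi k01 kr schi).
  by move: lk; rewrite k0 leNgt l0.
have [ka|ka|ka] := ltgtP alpha k; last 1 first.
- left; exists chi; split => //; first by rewrite ka.
  by exists (- 1); apply: le_lt_trans la; apply: chi_lt; rewrite ltrN10.
- right; have [] := kr.2 (k - alpha); first by rewrite subr_gt0.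
  by move=> x; rewrite opprB addrC subrK; exists x.
- by move: ak; rewrite leNgt ka.
Qed.

Lemma super_high : alpha < lev < 1 -> super_wave c chi ->
  upper_super_front c \/ exists x, chi x < alpha.
Proof.
move=> /andP[al l1] schi.
have [k k01 kl] := mon_left_limit mchi.
have lk : k <= lev by apply: le_trans (kl.1 (- 1)) _; apply: chi_lt; rewrite ltrN10.
have [ka|k1] := ge_react k01 (super_left_limit mchi k01 kl schi); last first.
  by move: lk; rewrite k1 leNgt l1.
have [ak|ak|ak] := ltgtP k alpha; last 1 first.
- left; exists chi; split => //; first by rewrite -ak.
  by exists 0; apply: lt_le_trans al _; exact: chi_ge.
- right; have [] := kl.2 (alpha - k); first by rewrite subr_gt0.
  by move=> x; rewrite addrC subrK; exists x.
- by move: ka; rewrite leNgt ak.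
Qed.

End LimitCases.

Section Sequences.
Variables (c_ h_ : nat -> R) (phi_ : nat -> R -> R).
Hypothesis tr : forall n, truncated_wave (c_ n) (h_ n) (phi_ n).
Hypothesis h_ge0 : forall n, 0 <= h_ n.
Hypothesis h_oo : forall M, \forall n \near \oo, M <= h_ n.

Let bounded_absurd s (y_ : nat -> R) M N : {homo s : m n / (m < n)%N} ->
  (\forall n \near \oo, y_ (s n) <= M) ->
  (\forall n \near \oo, h_ (s n) - y_ (s n) <= N) -> False.
Proof.
move=> hs yM yN; near \oo => n.
have : y_ (s n) <= M by near: n.
have : h_ (s n) - y_ (s n) <= N by near: n.
have : M + N + 1 <= h_ (s n) by near: n; exact: (subseq_infty hs (h_oo _)).
lra.
Unshelve. all: by end_near. Qed.

Variable c : R.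
Hypothesis c_c : c_ n @[n --> \oo] --> c.

Let cs_c s : {homo s : m n / (m < n)%N} -> c_ (s n) @[n --> \oo] --> c.
Proof. by move=> hs; exact: (cvg_comp _ _ (subseq_infty hs) c_c). Qed.

Let sub_c (y_ : nat -> R) s chi : {homo s : m n / (m < n)%N} ->
  mon_cvg (fun n x => phi_ (s n) (x + y_ (s n))) chi ->
  (forall M, \forall n \near \oo, M <= h_ (s n) - y_ (s n)) -> sub_wave c chi.
Proof.
move=> hs cchi; apply: (profile_sub tr cchi (cs_c hs)).
exact: nearW.
Qed.

Let super_c (y_ : nat -> R) s chi : {homo s : m n / (m < n)%N} ->
  mon_cvg (fun n x => phi_ (s n) (x + y_ (s n))) chi ->
  (forall M, \forall n \near \oo, M <= y_ (s n)) -> super_wave c chi.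
Proof.
move=> hs cchi; apply: (profile_super tr cchi (cs_c hs)).
exact: nearW.
Qed.

Let fixed chi : sub_wave c chi -> super_wave c chi ->
  forall x, wave_op c chi x = chi x.
Proof. by move=> s1 s2 x; apply/eqP; rewrite eq_le s1 s2. Qed.

Let half_alpha : 0 < alpha / 2 < alpha. Proof. by have /andP[] := alpha_itv; lra. Qed.
Let half_alpha1 : 0 < alpha / 2 <= 1. Proof. by have /andP[] := alpha_itv; lra. Qed.
Let beta_itv : alpha < (1 + alpha) / 2 < 1.
Proof. by have /andP[] := alpha_itv; lra. Qed.
Let beta1 : 0 < (1 + alpha) / 2 <= 1. Proof. by have /andP[] := alpha_itv; lra. Qed.
Let N10 : (- 1 : R) < 0. Proof. exact: ltrN10. Qed.

(* The limit at the crossing of [alpha / 2] starts from 0 and reaches [alpha]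
   or 1; the limit at the crossing of [(1 + alpha) / 2] starts from 0 or
   [alpha] and reaches 1. Each of them gives a front, a solution stopped by the
   left end of the window, or a front of the monostable problem below, resp.
   above, [alpha]. *)
Lemma mid_ge_cases : (forall n, alpha <= phi_ n (h_ n / 2)) ->
  ~ front c -> ~ half_sub_front c -> lower_sub_front c /\ upper_super_front c.
Proof.
move=> mid nf nh; split.
  have [y_ [y01 ylt ygt]] := truncated_crossings tr h_ge0 half_alpha1.
  have [s [chi [hs cchi [clt cge] dl dr]]] := profile_subseq tr y01 ylt ygt.
  have [_ mchi _ _] := cchi; have /andP[_ la] := half_alpha.
  have lo : exists x, chi x < alpha by exists (- 1); exact: le_lt_trans (clt _ N10) la.
  (* If the right end stayed near the crossing, the middle of the window would be far to the left of
     it, so [chi] would be at least [alpha] everywhere, against [chi (- 1) <= alpha / 2]. *)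
  case: dr => [dr|[M dr]]; last first.
    have := profile_mid_ge tr h_oo hs cchi mid dr (- 1).
    by move=> /(le_trans)/(_ (clt _ N10)); rewrite leNgt la.
  have schi := sub_c hs cchi dr.
  have [//|hi] := sub_low mchi clt cge half_alpha schi.
  case: dl => [dl|[M dl]].
    case: nf; have Schi := super_c hs cchi dl.
    exact: (fixed_front mchi (fixed schi Schi)).
  case: nh; exists chi; split => //; exists (- M).
  exact: (profile_left_zero tr cchi dl).
have [y_ [y01 ylt ygt]] := truncated_crossings tr h_ge0 beta1.
have [s [chi [hs cchi [clt cge] dl dr]]] := profile_subseq tr y01 ylt ygt.
have [_ mchi _ _] := cchi; have /andP[al _] := beta_itv.
have hi : exists x, alpha < chi x by exists 0; exact: lt_le_trans al (cge _ _).
case: dl => [dl|[M dl]]; last first.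
  case: dr => [dr|[N dr]]; last by case: (bounded_absurd hs dl dr).
  case: nh; exists chi; split => //; first exact: sub_c hs cchi dr.
  by exists (- M); exact: (profile_left_zero tr cchi dl).
have Schi := super_c hs cchi dl.
have [//|lo] := super_high mchi clt cge beta_itv Schi.
case: dr => [dr|[M dr]].
  case: nf; have schi := sub_c hs cchi dr.
  exact: (fixed_front mchi (fixed schi Schi)).
have [x] := lo; have := profile_mid_ge tr h_oo hs cchi mid dr x.
by rewrite leNgt => /negP.
Qed.

(** Mirror image of [mid_ge_cases]: the middle value is now below [alpha], so a limit that takes
    values on both sides of [alpha] can only be stopped by the right end of the window. *)
Lemma mid_lt_cases : (forall n, phi_ n (h_ n / 2) < alpha) ->
  ~ front c -> ~ half_super_front c -> lower_sub_front c /\ upper_super_front c.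
Proof.
move=> mid nf nh; split.
  have [y_ [y01 ylt ygt]] := truncated_crossings tr h_ge0 half_alpha1.
  have [s [chi [hs cchi [clt cge] dl dr]]] := profile_subseq tr y01 ylt ygt.
  have [_ mchi _ _] := cchi; have /andP[_ la] := half_alpha.
  have lo : exists x, chi x < alpha by exists (- 1); exact: le_lt_trans (clt _ N10) la.
  case: dr => [dr|[M dr]]; last first.
    case: dl => [dl|[N dl]]; last by case: (bounded_absurd hs dl dr).
    case: nh; exists chi; split => //; first exact: super_c hs cchi dl.
    by exists M; exact: (profile_right_one tr cchi dr).
  have schi := sub_c hs cchi dr.
  have [//|hi] := sub_low mchi clt cge half_alpha schi.
  case: dl => [dl|[M dl]].
    case: nf; have Schi := super_c hs cchi dl.
    exact: (fixed_front mchi (fixed schi Schi)).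
  have [x] := hi; have := profile_mid_le tr h_oo hs cchi mid dl x.
  by rewrite leNgt => /negP.
have [y_ [y01 ylt ygt]] := truncated_crossings tr h_ge0 beta1.
have [s [chi [hs cchi [clt cge] dl dr]]] := profile_subseq tr y01 ylt ygt.
have [_ mchi _ _] := cchi; have /andP[al _] := beta_itv.
have hi : exists x, alpha < chi x by exists 0; exact: lt_le_trans al (cge _ _).
case: dl => [dl|[M dl]]; last first.
  have := profile_mid_le tr h_oo hs cchi mid dl 0.
  by move=> /(le_trans (cge _ (lexx 0))); rewrite leNgt al.
have Schi := super_c hs cchi dl.
have [//|lo] := super_high mchi clt cge beta_itv Schi.
case: dr => [dr|[M dr]].
  case: nf; have schi := sub_c hs cchi dr.
  exact: (fixed_front mchi (fixed schi Schi)).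
case: nh; exists chi; split => //; exists M.
exact: (profile_right_one tr cchi dr).
Qed.

End Sequences.

(** * Incompatibility of the two monostable profiles *)

Variables (delta eta : R).
Hypothesis delta_gt0 : 0 < delta.
Hypothesis eta_gt0 : 0 < eta.
Hypothesis f_right : forall u : R, 0 <= u <= eta -> delta * u <= f (alpha + u).
Hypothesis f_left : forall u : R, 0 <= u <= eta -> f (alpha - u) <= - (delta * u).
Hypothesis Y_neq0 : ~ {ae P, forall w, Y w = 0}.

Let f_ge0 x : alpha <= x <= 1 -> 0 <= f x.
Proof.
rewrite le_eqVlt => /andP[/predU1P[<-|ax]]; first by rewrite falpha.
rewrite le_eqVlt => /predU1P[->|x1]; first by rewrite f1.
by rewrite ltW// f_gt0// ax.
Qed.

Let f_le0 x : 0 <= x <= alpha -> f x <= 0.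
Proof.
rewrite le_eqVlt => /andP[/predU1P[<-|x0]]; first by rewrite f0.
rewrite le_eqVlt => /predU1P[->|xa]; first by rewrite falpha.
by rewrite ltW// f_lt0// x0.
Qed.

Let Z1 c w := c * sg w + Y w.
Let Z2 c w := c * sg w.
Let mZ2 c : measurable_fun setT (Z2 c).
Proof. by apply: measurable_funM => //; exact: measurable_cst. Qed.
Let mZ1 c : measurable_fun setT (Z1 c). Proof. exact: (measurable_funD (mZ2 c) mY). Qed.

Lemma upper_drift c (K : nat) :
  L / (L + delta) < \int[P]_w \1_(trunc_set (Z1 c) (Z2 c) K%:R) w ->
  upper_super_front c -> 0 < drift P (Z1 c) (Z2 c) L delta K%:R \/
  {ae P, forall w, 0 <= Z1 c w /\ 0 <= Z2 c w}.
Proof.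
move=> KM [phi [mphi Sphi [phil phie] [y ya]]].
pose v x := phi x - alpha.
have /andP[a0 a1] := alpha_itv.
have eq_int x w : (v (x - Z1 c w) + ((L - 1) * v (x - Z2 c w) +
    f (alpha + v (x - Z2 c w)))) / L =
    react (phi (x - c * sg w - Y w)) (phi (x - c * sg w)) - alpha.
  have -> : alpha + v (x - Z2 c w) = phi (x - c * sg w) by rewrite /v /Z2; ring.
  have e1 : x - Z1 c w = x - c * sg w - Y w by rewrite /Z1; ring.
  by rewrite /v /react e1 /Z2; field; rewrite gt_eqF.
apply: (@drift_dichotomy _ _ _ _ _ _ _ _ eta v (fun u => f (alpha + u))) => //.
- split=> [x z xz|x]; first by rewrite lerD2r mphi.1.
  have /andP[_ p1] := mphi.2 x.
  by rewrite /v subr_ge0 phil lerBlDr (le_trans p1)// lerDl ltW.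
- by move=> e /phie[x xe]; exists x; rewrite /v ltrBlDl.
- by exists y; rewrite subr_gt0.
- move=> x; apply: f_ge0; have /andP[_ p1] := mphi.2 x.
  by rewrite /v addrC subrK phil.
- by move=> x vx; apply: f_right; rewrite vx /v subr_ge0 phil.
- move=> x; rewrite (_ : (fun w => _) = (fun w =>
    react (phi (x - c * sg w - Y w)) (phi (x - c * sg w)) - alpha)).
    by apply: bdd_measB; [exact: wave_op_bdd_meas|exact: bdd_meas_cst].
  by apply/funext => w; exact: eq_int.
- move=> x; under eq_Rintegral do rewrite eq_int.
  rewrite expectB; [|exact: wave_op_bdd_meas|exact: bdd_meas_cst].
  by rewrite expect_cst /v lerD2r; exact: Sphi.
Qed.

(** The reflected deficit [alpha - phi (- x)] is again nondecreasing and vanishes at -oo, so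
    [drift_dichotomy] applies. Reflection changes the sign of the displacements, hence of the
    drift. *)
Lemma lower_drift c (K : nat) :
  L / (L + delta) < \int[P]_w \1_(trunc_set (Z1 c) (Z2 c) K%:R) w ->
  lower_sub_front c -> drift P (Z1 c) (Z2 c) L delta K%:R < 0 \/
  {ae P, forall w, Z1 c w <= 0 /\ Z2 c w <= 0}.
Proof.
move=> KM [phi [mphi sphi [phir phie] [y ya]]].
pose v x := alpha - phi (- x).
have /andP[a0 a1] := alpha_itv.
have eq_int x w : (v (x - - Z1 c w) + ((L - 1) * v (x - - Z2 c w) +
    - f (alpha - v (x - - Z2 c w)))) / L =
    alpha - react (phi (- x - c * sg w - Y w)) (phi (- x - c * sg w)).
  have e1 : - (x - - Z1 c w) = - x - c * sg w - Y w by rewrite /Z1; ring.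
  have e2 : - (x - - Z2 c w) = - x - c * sg w by rewrite /Z2; ring.
  have -> : alpha - v (x - - Z2 c w) = phi (- x - c * sg w).
    by rewrite /v e2; ring.
  by rewrite /v /react e1 e2; field; rewrite gt_eqF.
have mN (Z : T -> R) : measurable_fun setT Z -> measurable_fun setT (fun w => - Z w).
  by move=> mZ; exact: measurableT_comp.
have [D|D] : 0 < drift P (fun w => - Z1 c w) (fun w => - Z2 c w) L delta K%:R \/
    {ae P, forall w, 0 <= - Z1 c w /\ 0 <= - Z2 c w}; last 2 first.
- by left; rewrite -oppr_gt0 -driftN.
- by right; apply: filterS D => w; rewrite !oppr_ge0.
apply: (@drift_dichotomy _ _ _ _ _ _ _ _ eta v (fun u => - f (alpha - u))) => //.
- exact: mN.
- exact: mN.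
- split=> [x z xz|x]; first by rewrite lerD2l lerN2 mphi.1// lerN2.
  have /andP[p0 _] := mphi.2 (- x).
  by rewrite /v subr_ge0 phir lerBlDr (le_trans (ltW a1))// lerDl.
- by move=> e /phie[x xe]; exists (- x); rewrite /v opprK ltrBlDl -ltrBlDr.
- by exists (- y); rewrite /v opprK subr_gt0.
- move=> x; rewrite oppr_ge0; apply: f_le0; have /andP[p0 _] := mphi.2 (- x).
  by rewrite /v opprB addrC subrK phir p0.
- move=> x vx; rewrite lerNr; apply: f_left; rewrite vx /v subr_ge0 phir//.
- move=> x; rewrite (_ : (fun w => _) = (fun w =>
    alpha - react (phi (- x - c * sg w - Y w)) (phi (- x - c * sg w)))).
    by apply: bdd_measB; [exact: bdd_meas_cst|exact: wave_op_bdd_meas].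
  by apply/funext => w; exact: eq_int.
- move=> x; under eq_Rintegral do rewrite eq_int.
  rewrite expectB; [|exact: bdd_meas_cst|exact: wave_op_bdd_meas].
  by rewrite expect_cst /v lerD2l lerN2; exact: sphi.
- by rewrite trunc_setN.
Qed.

(* The two monostable profiles force the mean displacement to be positive and
   negative, respectively, except when both are steps and [c = 0]. *)
Lemma lower_upper_absurd c : lower_sub_front c -> upper_super_front c -> False.
Proof.
move=> lo up; apply: Y_neq0.
have [K KM] := trunc_mass P (mZ1 c) (mZ2 c) L_gt1 delta_gt0.
have bint := drift_bdd L delta (mZ1 c) (mZ2 c) K%:R.
have nn : 0 < L - 1 + delta by rewrite addr_gt0// subr_gt0.
have [D|Hup] := upper_drift KM up; have [D'|Hlo] := lower_drift KM lo.
- by have := lt_trans D D'; rewrite ltxx.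
- move: D; rewrite ltNge -oppr_ge0 => /negP[].
  rewrite -driftN//; apply: expect_ae_ge0.
    by apply: drift_bdd; apply: measurableT_comp.
  apply: filterS Hlo => w [z1 z2]; rewrite mulr_ge0// ?indicE//.
  by rewrite addr_ge0 ?mulr_ge0 ?oppr_ge0// ltW.
- move: D'; rewrite ltNge => /negP[].
  apply: expect_ae_ge0 => //.
  apply: filterS Hup => w [z1 z2]; rewrite mulr_ge0// ?indicE//.
  by apply: addr_ge0 => //; apply: mulr_ge0 => //; exact: ltW.
- apply: filterS2 Hup Hlo => w [z1 z2] [z1' z2'].
  have z20 : Z2 c w = 0 by apply/eqP; rewrite eq_le z2 z2'.
  have z10 : Z1 c w = 0 by apply/eqP; rewrite eq_le z1 z1'.
  by move: z10; rewrite /Z1 (_ : c * sg w = 0)// add0r.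
Qed.

(* The limit profile would be a nonconstant subsolution for every speed. *)
Lemma fast_mid_ge_absurd (c_ h_ : nat -> R) (phi_ : nat -> R -> R) :
  (forall n, truncated_wave (c_ n) (h_ n) (phi_ n)) -> (forall n, 0 <= h_ n) ->
  (forall M, \forall n \near \oo, M <= h_ n) ->
  (forall M, \forall n \near \oo, M <= c_ n) ->
  ~ forall n, alpha <= phi_ n (h_ n / 2).
Proof.
move=> tr h0 h_oo c_oo mid.
have half_alpha1 : 0 < alpha / 2 <= 1 by have /andP[] := alpha_itv; lra.
have la : alpha / 2 < alpha by have /andP[] := alpha_itv; lra.
have [y_ [y01 ylt ygt]] := truncated_crossings tr h0 half_alpha1.
have [s [chi [hs cchi [clt cge] _ dr]]] := profile_subseq tr y01 ylt ygt.
have [_ mchi _ _] := cchi.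
case: dr => [dr|[M dr]]; last first.
  have := profile_mid_ge tr h_oo hs cchi mid dr (- 1).
  by move=> /(le_trans)/(_ (clt _ (ltrN10 _))); rewrite leNgt la.
have schi (m : nat) : sub_wave m%:R chi.
  apply: (profile_sub tr cchi (cvg_cst (m%:R : R)) _ dr).
  exact: (subseq_infty hs (c_oo _)).
have [k k01 kl] := mon_left_limit mchi.
have [k0|ak] := le_react k01 (sub_left_limit mchi k01 kl (schi 0%N)); last first.
  have := le_trans (kl.1 (- 1)) (clt _ (ltrN10 _)).
  by move=> /(le_trans ak); rewrite leNgt la.
have := sub_all_speeds mchi k01 (x := 0) kl (fun m => schi m 0).
rewrite react_diag k0 f0 mul0r addr0 => /(le_trans (cge 0 (lexx 0))).
by rewrite leNgt; have /andP[->] := half_alpha1.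
Qed.

(** A supersolution for all speeds [- m%:R] would be at least 1 at [- 1], where the recentring keeps
    it below 1. *)
Lemma slow_mid_lt_absurd (c_ h_ : nat -> R) (phi_ : nat -> R -> R) :
  (forall n, truncated_wave (c_ n) (h_ n) (phi_ n)) -> (forall n, 0 <= h_ n) ->
  (forall M, \forall n \near \oo, M <= h_ n) ->
  (forall M, \forall n \near \oo, c_ n <= - M) ->
  ~ forall n, phi_ n (h_ n / 2) < alpha.
Proof.
move=> tr h0 h_oo c_oo mid.
have beta1 : 0 < (1 + alpha) / 2 <= 1 by have /andP[] := alpha_itv; lra.
have /andP[al b1] : alpha < (1 + alpha) / 2 < 1 by have /andP[] := alpha_itv; lra.
have [y_ [y01 ylt ygt]] := truncated_crossings tr h0 beta1.
have [s [chi [hs cchi [clt cge] dl _]]] := profile_subseq tr y01 ylt ygt.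
have [_ mchi _ _] := cchi.
case: dl => [dl|[M dl]]; last first.
  have := profile_mid_le tr h_oo hs cchi mid dl 0.
  by move=> /(le_trans (cge _ (lexx 0))); rewrite leNgt al.
have schi (m : nat) : super_wave (- m%:R) chi.
  apply: (profile_super tr cchi (cvg_cst (- m%:R : R)) _ dl).
  exact: (subseq_infty hs (c_oo _)).
have [k k01 kr] := mon_right_limit mchi.
have [ka|k1] := ge_react k01 (super_right_limit mchi k01 kr (schi 0%N)).
  have := le_trans (cge _ (lexx 0)) (kr.1 0).
  by move=> /le_trans/(_ ka); rewrite leNgt al.
have := super_all_speeds mchi k01 (x := - 1) kr (fun m => schi m (- 1)).
rewrite react_diag k1 f1 mul0r addr0 => /le_trans/(_ (clt _ (ltrN10 _))).
by rewrite leNgt b1.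
Qed.

(** * Speeds at which the middle value switches side of [alpha] *)

Let tw c n := sval (cid (truncated_wave_exists c (ler0n R n))).
Let tw_trunc c n : truncated_wave c n%:R (tw c n).
Proof. exact: svalP (cid (truncated_wave_exists c (ler0n R n))). Qed.

Let nat_oo (g : nat -> nat) : (forall n, (n <= g n)%N) ->
  forall M : R, \forall n \near \oo, M <= (g n)%:R.
Proof.
move=> hg M; near=> n; apply: (@le_trans _ _ n%:R); last by rewrite ler_nat.
near: n; exact: nbhs_infty_ger.
Unshelve. all: by end_near. Qed.

(** Otherwise there are counterexamples with window and speed both beyond any [N], and their
    sequence contradicts [fast_mid_ge_absurd]. *)
Lemma speed_upper_bound : exists N : nat, forall n (c : R), (N <= n)%N ->
  N%:R <= c -> tw c n (n%:R / 2) < alpha.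
Proof.
apply: contrapT => H.
have {}H (N : nat) : exists nc : nat * R,
    [/\ (N <= nc.1)%N, N%:R <= nc.2 & alpha <= tw nc.2 nc.1 (nc.1%:R / 2)].
  apply: contrapT => HN; apply: H; exists N => n c Nn Nc.
  by rewrite ltNge; apply/negP => an; apply: HN; exists (n, c).
pose g N := sval (cid (H N)).
have gP N := svalP (cid (H N)).
apply: (@fast_mid_ge_absurd (fun N => (g N).2) (fun N => (g N).1%:R)
  (fun N => tw (g N).2 (g N).1)) => //.
- by apply: nat_oo => N; case: (gP N).
- move=> M; near=> N; apply: (@le_trans _ _ N%:R); last by case: (gP N).
  by near: N; exact: nbhs_infty_ger.
- by move=> N; case: (gP N).
Unshelve. all: by end_near. Qed.

Lemma speed_lower_bound : exists N : nat, forall n (c : R), (N <= n)%N ->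
  c <= - N%:R -> alpha <= tw c n (n%:R / 2).
Proof.
apply: contrapT => H.
have {}H (N : nat) : exists nc : nat * R,
    [/\ (N <= nc.1)%N, nc.2 <= - N%:R & tw nc.2 nc.1 (nc.1%:R / 2) < alpha].
  apply: contrapT => HN; apply: H; exists N => n c Nn Nc.
  by rewrite leNgt; apply/negP => an; apply: HN; exists (n, c).
pose g N := sval (cid (H N)).
have gP N := svalP (cid (H N)).
apply: (@slow_mid_lt_absurd (fun N => (g N).2) (fun N => (g N).1%:R)
  (fun N => tw (g N).2 (g N).1)) => //.
- by apply: nat_oo => N; case: (gP N).
- move=> M; near=> N; apply: (@le_trans _ _ (- N%:R)); first by case: (gP N).
  by rewrite lerN2; near: N; exact: nbhs_infty_ger.
- by move=> N; case: (gP N).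
Unshelve. all: by end_near. Qed.

(** The waves [tw c n] are chosen independently for each [c], so continuity in [c] is replaced by a
    walk from [- N%:R] in steps of [n.+1%:R^-1] up to the first speed with middle value below
    [alpha]. *)
Lemma speed_switch : exists N : nat, forall n, (N <= n)%N -> exists c,
  [/\ - N%:R <= c <= N%:R, alpha <= tw c n (n%:R / 2) &
      tw (c + n.+1%:R^-1) n (n%:R / 2) < alpha].
Proof.
have [N1 H1] := speed_upper_bound; have [N2 H2] := speed_lower_bound.
pose N := maxn N1 N2.
have N1N : N1%:R <= N%:R :> R by rewrite ler_nat leq_maxl.
have N2N : N2%:R <= N%:R :> R by rewrite ler_nat leq_maxr.
exists N => n Nn.
have n1N : (N1 <= n)%N := leq_trans (leq_maxl _ _) Nn.
have n2N : (N2 <= n)%N := leq_trans (leq_maxr _ _) Nn.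
pose c j : R := - N%:R + j%:R * n.+1%:R^-1.
have cS j : c j.+1 = c j + n.+1%:R^-1 by rewrite /c -natr1 mulrDl mul1r addrA.
have ex : exists j, tw (c j) n (n%:R / 2) < alpha.
  exists (n.+1 * (N + N))%N; apply: H1 => //.
  by rewrite /c natrM mulrAC divff// mul1r natrD; lra.
case: (ex_minnP ex) => [[|j] jlt jmin].
  by move: jlt; rewrite ltNge H2// /c mul0r addr0 lerN2.
exists (c j).
have jge : alpha <= tw (c j) n (n%:R / 2).
  by rewrite leNgt; apply/negP => /jmin; rewrite ltnn.
split => //; last by rewrite -cS.
apply/andP; split; first by rewrite /c lerDl.
rewrite leNgt; apply/negP => /ltW Nc; move: jge; rewrite leNgt => /negP; apply.
by apply: H1 => //; exact: le_trans Nc.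
Qed.

(** The waves just before and just after the switch have speeds with a common limit [c]. Without a
    front, the first sequence yields a half-line subsolution and the second a half-line
    supersolution at this [c], since the other alternative is excluded by [lower_upper_absurd];
    together they give a front. *)
Lemma front_exists : exists c, front c.
Proof.
apply: contrapT => nf.
have nf' c : ~ front c by move=> fc; apply: nf; exists c.
have [N HN] := speed_switch.
have {}HN n := HN (n + N)%N (leq_addl n N).
pose b n := sval (cid (HN n)).
have bP n := svalP (cid (HN n)).
have N0 : 0 < 2 * N%:R + 1 :> R by rewrite ltr_wpDl// mulr_ge0.
(* Speeds rescaled to [[0, 1]]; the [+ 1] keeps the denominator positive when [N] is 0. *)
pose u (_ n : nat) : R := (b n + N%:R) / (2 * N%:R + 1).
have u01 k n : 0 <= u k n <= 1.
  have [/andP[l r] _ _] := bP n; rewrite -/(b n) in l r.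
  rewrite /u ler_pdivlMr// ler_pdivrMr//; apply/andP; split; lra.
have [s [hs /(_ 0%N)[l cl]]] := diagonal_subsequence u01.
pose c := (2 * N%:R + 1) * l - N%:R.
have cb : b (s n) @[n --> \oo] --> c.
  rewrite (_ : (fun n => b (s n)) = (fun n => (2 * N%:R + 1) * u 0%N (s n) - N%:R)).
    by apply: cvgB; [apply: cvgMr|exact: cvg_cst].
  by apply/funext => n; rewrite /u mulrC divfK ?gt_eqF// addrK.
have sn n : (n <= s n)%N.
  by elim: n => // n IH; exact: leq_ltn_trans IH (hs _ _ _).
have cb' : b (s n) + (s n + N).+1%:R^-1 @[n --> \oo] --> c.
  rewrite -[X in _ --> X]addr0; apply: cvgD => //.
  apply: (@squeeze_cvgr _ _ _ _ (fun=> 0) (fun n => n.+1%:R^-1)).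
  - apply: nearW => n; rewrite invr_ge0 ler0n/= lef_pV2 ?posrE//.
    by rewrite ler_nat ltnS (leq_trans (sn n))// leq_addr.
  - exact: cvg_cst.
  - exact: cvg_harmonic.
have h0 n : 0 <= (s n + N)%:R :> R by [].
have hoo : forall M : R, \forall n \near \oo, M <= (s n + N)%:R.
  by apply: nat_oo => n; rewrite (leq_trans (sn n))// leq_addr.
have tr1 n := tw_trunc (b (s n)) (s n + N).
have tr2 n := tw_trunc (b (s n) + (s n + N).+1%:R^-1) (s n + N).
have absurd : ~ (lower_sub_front c /\ upper_super_front c).
  by move=> [lo up]; exact: lower_upper_absurd lo up.
have sub : half_sub_front c.
  apply: contrapT => ns; apply: absurd.
  apply: (mid_ge_cases tr1 h0 hoo cb) => // n.
  by have [] := bP (s n).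
have super : half_super_front c.
  apply: contrapT => ns; apply: absurd.
  apply: (mid_lt_cases tr2 h0 hoo cb') => // n.
  by have [] := bP (s n).
exact: (nf' c) (half_fronts_front sub super).
Qed.
End Operator.

(** * From fixed points to solutions of the evolution equation *)

Section ExponentialVariable.
Variable R : realType.
Notation leb := (@lebesgue_measure R).

Lemma ge0_integral_scale (a : R) (k : R -> \bar R) : 0 < a ->
  measurable_fun setT k -> (forall x, 0 <= k x)%E ->
  (\int[leb]_x k x = a%:E * \int[leb]_x k (a * x)%R)%E.
Proof.
move=> a0 mk k0.
have ma : measurable_fun setT (fun x : measurableTypeR R => a * x : measurableTypeR R).
  exact: measurable_funM.
pose an : {nonneg R} := NngNum (ltW a0).
have mE A : measurable A -> leb A = mscale an (pushforward leb
    (fun x : measurableTypeR R => a * x : measurableTypeR R)) A.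
  apply: lebesgue_measure_unique => _ [[b c]] _ <-.
  have pre : (fun x => a * x) @^-1` `]b, c]%classic = `]b / a, c / a]%classic.
    by apply/seteqP; split => x /=; rewrite !in_itv/= ltr_pdivrMr// ler_pdivlMr// (mulrC a).
  rewrite -[RHS]/(a%:E * leb ((fun x : R => (a * x)%R) @^-1` `]b, c]%classic))%E pre.
  rewrite !lebesgue_measure_itv/= !lte_fin ltr_pM2r ?invr_gt0//.
  case: ifP => _; last by rewrite mule0.
  rewrite -!EFinD -EFinM; congr EFin; field; rewrite gt_eqF//.
rewrite -[X in (_ * X)%E]/(\int[leb]_(x in
  (fun x : measurableTypeR R => (a * x)%R : measurableTypeR R) @^-1` setT)
  (k \o (fun x : measurableTypeR R => (a * x)%R : measurableTypeR R)) x)%E.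
rewrite -ge0_integral_pushforward// -[a]/(an%:num) -ge0_integral_mscale//.
by apply: eq_measure_integral => A mA _; exact: mE.
Qed.

Definition unif01 : probability (measurableTypeR R) R := uniform_prob (@ltr01 R).

(** Conditioned on [u <= a], the uniform law is a copy of itself contracted by [a]; in terms of
    [- ln u] this is memorylessness. *)
Lemma unif01_scale (a : R) (g : R -> R) : 0 < a <= 1 ->
  measurable_fun setT g -> (forall u, 0 <= g u <= 1) ->
  \int[unif01]_u (\1_(`]-oo, a]%classic : set R) u * g u) = a * \int[unif01]_u g (a * u).
Proof.
move=> /andP[a0 a1] mg g01.
have g0 u : 0 <= g u by have /andP[] := g01 u.
have mga : measurable_fun setT (fun u : R => g (a * u)).
  by apply: (measurableT_comp mg); exact: measurable_funM.
have m1 : measurable_fun setT (\1_(`]-oo, a]%classic : set R) : R -> R).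
  exact: measurable_indic.
have fin : (\int[unif01]_u (g (a * u))%:E)%E \is a fin_num.
  apply: integrable_fin_num => //; apply: (@bdd_meas_integrable _ _ _ unif01).
  by apply: (bdd_meas_range mga) => u; exact: g01.
have -> : a * \int[unif01]_u g (a * u) = fine (a%:E * \int[unif01]_u (g (a * u))%:E)%E.
  by rewrite fineM.
congr fine; rewrite /unif01 !integral_uniform//=.
- rewrite subr0 invr1 !mul1e integral_mkcond [in RHS]integral_mkcond.
  rewrite (ge0_integral_scale a0)//.
  + congr (_ * _)%E; apply: eq_integral => u _; rewrite !patchE.
    rewrite !mem_setE !in_itv/= pmulr_rge0//.
    have au_a : (a * u <= a) = (u <= 1) by rewrite -[X in _ <= X]mulr1 ler_pM2l.
    rewrite indicE mem_setE in_itv/= au_a.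
    case: (0 <= u) => //=; case: (boolP (u <= 1)) => u1; last first.
      by rewrite mul0r; case: ifP.
    by rewrite mul1r ifT// (le_trans _ a1)// au_a.
  + apply/(measurable_restrictT _ _).1 => //; apply: measurable_funTS.
    by apply/measurable_EFinP; exact: measurable_funM.
  + by move=> x; apply: erestrict_ge0 => y _; rewrite lee_fin mulr_ge0// indicE.
- by apply/measurable_EFinP.
- by move=> u; rewrite lee_fin.
- by apply/measurable_EFinP; exact: measurable_funM.
- by move=> u; rewrite lee_fin mulr_ge0// indicE.
Qed.

(** Inverse-transform sampling: under the uniform law, [- ln u] is exponential. The value 1 off
    [(0, 1)] concerns a null set and keeps [expo] positive everywhere. *)
Definition expo (u : R) := if 0 < u < 1 then - ln u else 1.

Lemma expo_gt0 u : 0 < expo u.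
Proof.
by rewrite /expo; case: ifP => // /andP[u0 u1]; rewrite oppr_gt0 ln_lt0// u0.
Qed.

Lemma measurable_expo : measurable_fun setT (expo : measurableTypeR R -> R).
Proof.
apply: measurable_fun_ifT => //; last first.
  by apply: measurableT_comp => //; exact: measurable_ln.
by apply: measurable_and; exact: measurable_fun_ltr.
Qed.

Lemma unif01_ae : {ae unif01, forall u : measurableTypeR R, 0 < (u : R) < 1}.
Proof.
exists (~` `]0, 1[%classic); split.
- exact: measurableC.
- rewrite -[LHS]/(\int[leb]_(x in ~` (`]0%R, 1%R[%classic : set R)) (uniform_pdf 0 1 x)%:E)%E.
  rewrite integral_uniform_pdf (_ : _ `&` _ = [set 0] `|` [set 1]); last first.
    apply/seteqP; split => [x /=|x [->|->]/=]; last 2 first.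
    - by rewrite !in_itv/= ltxx lexx ler01.
    - by rewrite !in_itv/= ltxx andbF lexx ler01.
    rewrite !in_itv/= => -[/negP + /andP[x0 x1]].
    rewrite negb_and -!leNgt => /orP[x0'|x1']; [left|right]; apply/eqP.
      by rewrite eq_le x0 x0'.
    by rewrite eq_le x1 x1'.
  apply: null_set_integral => //; first exact: measurableU.
    by apply/measurable_EFinP/measurable_funTS; exact: measurable_uniform_pdf.
  by rewrite null_set_setU//; exact: lebesgue_measure_set1.
- by move=> u /= H; rewrite in_itv.
Qed.

(** Formally a resolvent: [phi := expo_mean G c] solves [phi + c * phi' = G]. *)
Definition expo_mean (G : R -> R) (c x : R) := \int[unif01]_u G (x - c * expo u).

(* The exponential law is memoryless: its restriction to [h, +oo[ is a copy,
   translated by [h] and of mass [expR (- h)], of the law itself. *)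
Lemma expo_mean_step (G : R -> R) c x h lo hi : mon G -> 0 <= h ->
  (forall s, 0 <= s <= h -> lo <= G (x - c * s) <= hi) ->
  expR (- h) * expo_mean G c (x - c * h) + (1 - expR (- h)) * lo <=
    expo_mean G c x <=
  expR (- h) * expo_mean G c (x - c * h) + (1 - expR (- h)) * hi.
Proof.
move=> mG h0 lohi; set a := expR (- h).
have a0 : 0 < a by exact: expR_gt0.
have a1 : a <= 1 by rewrite /a -expR0 ler_expR oppr_le0.
have a01 : 0 < a <= 1 by rewrite a0.
have mexp y : measurable_fun setT (fun u : measurableTypeR R => G (y - c * expo u)).
  apply: (measurableT_comp (mon_measurable mG)); apply: measurable_funB => //.
  by apply: measurable_funM => //; exact: measurable_expo.
have bG y : bdd_meas (fun u : measurableTypeR R => G (y - c * expo u)).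
  by apply: (bdd_meas_range (mexp y)) => u; exact: mG.2.
(* Up to a null set, the indicator of the event that the exponential variable is at least [h]. *)
pose chi u : R := \1_(`]-oo, a]%classic : set R) u.
have bchi : bdd_meas (chi : measurableTypeR R -> R).
  by apply: bdd_meas_indic.
have Echi : \int[unif01]_u chi u = a.
  transitivity (\int[unif01]_u (chi u * 1)).
    by apply: eq_Rintegral => u _; rewrite mulr1.
  rewrite (unif01_scale (g := fun=> 1) a01)//; last by move=> u; rewrite lexx ler01.
  by rewrite (expect_cst unif01) mulr1.
have b1chi : bdd_meas ((fun u => 1 - chi u) : measurableTypeR R -> R).
  by apply: bdd_measB => //; exact: bdd_meas_cst.
have E1chi : \int[unif01]_u (1 - chi u) = 1 - a.
  rewrite (expectB unif01 (bdd_meas_cst _ _) bchi) Echi.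
  by rewrite (expect_cst unif01).
have bs y := bdd_measM bchi (bG y).
have bs' y := bdd_measM b1chi (bG y).
have split_mean : expo_mean G c x = \int[unif01]_u (chi u * G (x - c * expo u)) +
    \int[unif01]_u ((1 - chi u) * G (x - c * expo u)).
  rewrite -(expectD unif01 (bs x) (bs' x)); apply: eq_Rintegral => u _; ring.
have mau : measurable_fun setT (fun u : measurableTypeR R => G (x - c * expo (a * u))).
  apply: (measurableT_comp (mexp x)) => /=; exact: measurable_funM.
have bau : bdd_meas (fun u : measurableTypeR R => G (x - c * expo (a * u))).
  by apply: (bdd_meas_range mau) => u; exact: mG.2.
(* For [u] in [(0, 1)] one has [expo (a * u) = expo u + h]. *)
have tail : \int[unif01]_u G (x - c * expo (a * u)) = expo_mean G c (x - c * h).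
  have H : {ae unif01, forall u : measurableTypeR R, G (x - c * expo (a * u)) = G (x - c * h - c * expo u)}.
    apply: filterS unif01_ae => u /andP[u0 u1]; congr G.
    rewrite /expo u0 u1/= ifT; last first.
      by rewrite mulr_gt0//= (le_lt_trans _ u1)// ger_pMl.
    by rewrite lnM ?posrE// /a expRK; ring.
  by apply/eqP; rewrite eq_le; apply/andP; split;
    apply: (expect_ae_le (P := unif01)) => //; apply: filterS H => u ->.
have head : \int[unif01]_u (chi u * G (x - c * expo u)) = a * expo_mean G c (x - c * h).
  rewrite -tail; apply: (unif01_scale (g := fun u => G (x - c * expo u)) a01).
    exact: mexp.
  by move=> u; exact: mG.2.
have chi_lo_hi u : 0 < u < 1 -> (1 - chi u) * lo <= (1 - chi u) * G (x - c * expo u) <= (1 - chi u) * hi.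
  move=> /andP[u0 u1]; rewrite /chi indicE; case: (boolP (u \in _)) => [_|].
    by rewrite subrr !mul0r lexx.
  move=> /negP; rewrite inE/= in_itv/= => /negP; rewrite -ltNge => au.
  rewrite subr0 !mul1r; apply: lohi; rewrite ltW ?expo_gt0//=.
  rewrite /expo u0 u1 lerNl -(expRK (- h)) ler_ln ?posrE//; exact: ltW.
rewrite split_mean head !lerD2l; apply/andP; split.
- rewrite -E1chi mulrC -(expectZ unif01)//.
  apply: (expect_ae_le (P := unif01)) => //; first exact: bdd_measZ.
  by apply: filterS unif01_ae => u /chi_lo_hi/andP[+ _]; rewrite mulrC.
- rewrite -E1chi mulrC -(expectZ unif01)//.
  apply: (expect_ae_le (P := unif01)) => //; first exact: bdd_measZ.
  by apply: filterS unif01_ae => u /chi_lo_hi/andP[_ +]; rewrite [X in _ <= X -> _]mulrC.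
Qed.

End ExponentialVariable.

(** * Probability spaces for the displacement and the exponential variable *)

Section ProbabilityOfMeasure.
Context d (T : measurableType d) (R : realType).
Variable m : {measure set T -> \bar R}.
Hypothesis m1 : m setT = 1%E.

Definition measure_fun : set T -> \bar R := m.

HB.instance Definition _ := Measure.on measure_fun.
HB.instance Definition _ := Measure_isProbability.Build _ _ _ measure_fun m1.

Definition prob_of_measure : probability T R := measure_fun.

End ProbabilityOfMeasure.

Section ProductProbability.
Context d1 d2 (T1 : measurableType d1) (T2 : measurableType d2) (R : realType).
Variables (m1 : probability T1 R) (m2 : probability T2 R).

Let prod_setT : ((m1 \x m2) setT = 1)%E.
Proof.
rewrite -setXTT product_measure1E// -[RHS]mule1.
by congr (_ * _)%E; exact: probability_setT.
Qed.

Definition prod_prob : probability (T1 * T2)%type R :=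
  HB.pack (m1 \x m2)%E (Measure_isProbability.Build _ _ _ (m1 \x m2)%E prod_setT).

(** The cylinder over [Y != 0] lies in the exceptional null set, and its product mass equals the
    mass of its base. *)
Lemma prod_prob_ae_snd (Y : T2 -> R) : measurable_fun setT Y ->
  {ae prod_prob, forall w, Y w.2 = 0} -> {ae m2, forall y, Y y = 0}.
Proof.
move=> mY [N [mN N0 YN]].
have mA : measurable [set y | Y y != 0].
  have := mY measurableT _ (measurableC (measurable_set1 (0 : R))).
  rewrite setTI; congr measurable; apply/seteqP.
  by split => y /= => [/eqP|/eqP].
exists [set y | Y y != 0]; split => //; last by move=> y /= /eqP.
have H : prod_prob (setT `*` [set y | Y y != 0]) = m2 [set y | Y y != 0].
  rewrite -[LHS]/((m1 \x m2)%E (setT `*` [set y | Y y != 0])) product_measure1E//.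
  by rewrite -[RHS]mul1e; congr (_ * _)%E; exact: probability_setT.
apply/eqP; rewrite eq_le measure_ge0 andbT -N0 -H.
apply: le_measure; rewrite ?inE//; first exact: measurableX.
by move=> [x y] [_ /= Yy]; apply: YN => /=; apply/eqP.
Qed.

End ProductProbability.

(** * Solutions of the evolution equation from fixed points *)

Section FrontSolution.
Variables (R : realType) (nu : probability (measurableTypeR R) R).
Variables (f : R -> R) (L : R).
Hypothesis L_gt1 : 1 < L.
Hypothesis f_lip : forall x y, `|f x - f y| <= (L - 1) * `|x - y|.
Hypothesis f0 : f 0 = 0.
Hypothesis f1 : f 1 = 0.

Let L_gt0 : 0 < L. Proof. exact: lt_trans L_gt1. Qed.
Let P := prod_prob (unif01 R) nu.
Let sg (w : measurableTypeR R * measurableTypeR R) : R := expo w.1.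
Let Y (w : measurableTypeR R * measurableTypeR R) : R := w.2.

(* The right-hand side [mu * phi - phi + f phi] of the equation is
   [L * (source phi - phi)]. *)
Definition source phi x := \int[nu]_y react f L (phi (x - y)) (phi x).

Let source_op phi x : source phi x = wave_op nu (fun=> 1) (fun y => y) f L 0 phi x.
Proof. by apply: eq_Rintegral => y _; rewrite mul0r subr0. Qed.

Lemma source_mon phi : mon phi -> mon (source phi).
Proof.
move=> mphi; have -> : source phi = wave_op nu (fun=> 1) (fun y => y) f L 0 phi.
  by apply/funext => x; exact: source_op.
exact: wave_op_mon.
Qed.

Let bdd_shift phi x : mon phi -> bdd_meas (fun y : measurableTypeR R => phi (x - y)).
Proof.
move=> mphi; apply: (@bdd_meas_range _ _ _ _ 0 1) => [|y]; last exact: mphi.2.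
by apply: (measurableT_comp (mon_measurable mphi)); exact: measurable_funB.
Qed.

Lemma sourceE phi x : mon phi ->
  L * (source phi x - phi x) = Defs.conv nu phi x - phi x + f (phi x).
Proof.
move=> mphi.
have -> : source phi x = \int[nu]_y (L^-1 * phi (x - y) + ((L - 1) * phi x + f (phi x)) / L).
  by apply: eq_Rintegral => y _; rewrite /react; ring.
have bs := bdd_shift x mphi.
rewrite (expectD nu (bdd_measZ L^-1 bs) (bdd_meas_cst _ _)) (expectZ nu L^-1 bs) expect_cst.
rewrite -[\int[nu]_y phi (x - y)]/(Defs.conv nu phi x).
by field; rewrite gt_eqF.
Qed.

(** Tonelli: averaging over the [nu]-variable first gives [source phi] at the point displaced by the
    exponential variable. *)
Lemma wave_op_expo_mean c phi x : mon phi ->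
  wave_op P sg Y f L c phi x = expo_mean (source phi) c x.
Proof.
move=> mphi; rewrite /wave_op /expo_mean /Rintegral; congr fine.
have mexp : measurable_fun setT sg.
  exact: (measurableT_comp (@measurable_expo R) measurable_fst).
have b := wave_op_bdd_meas mexp (measurable_snd : measurable_fun setT Y) L_gt1 f_lip f0 f1 c x mphi.
have mb := b.1.
rewrite -[LHS]/(\int[unif01 R \x nu]_w (react f L (phi (x - c * sg w - Y w)) (phi (x - c * sg w)))%:E)%E.
rewrite fubini_tonelli1/=; last 2 first.
- by apply/measurable_EFinP.
- move=> w; rewrite lee_fin.
  by have /andP[] := react_01 L_gt1 f_lip f0 f1 (mphi.2 (x - c * sg w - Y w)) (mphi.2 (x - c * sg w)).
apply: eq_integral => u _; rewrite /fubini_F/= /source /Rintegral fineK//.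
apply: integrable_fin_num => //; apply: bdd_meas_integrable.
apply: (react_bdd_meas L_gt1 f_lip f0 f1); [|exact: measurable_cst| |]; last 2 first.
- by move=> y; exact: mphi.2.
- by move=> y; exact: mphi.2.
exact: (bdd_shift _ mphi).1.
Qed.

Section Fixed.
Variables (c : R) (phi : R -> R).
Hypothesis mphi : mon phi.
Hypothesis fix_phi : forall x, wave_op P sg Y f L c phi x = phi x.

Let G := source phi.
Let mG : mon G. Proof. exact: source_mon. Qed.

Let phiE x : phi x = expo_mean G c x.
Proof. by rewrite -wave_op_expo_mean// fix_phi. Qed.

Let expN (h : R) : 0 <= h -> [/\ h - h ^+ 2 <= 1 - expR (- h), 1 - expR (- h) <= h &
  0 <= 1 - expR (- h)].
Proof.
move=> h0; have e1 := expR_ge1Dx (- h); have e2 := expR_ge1Dx h.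
have e0 := expR_gt0 (- h).
have ee : expR (- h) * expR h = 1 by rewrite -expRD addNr expR0.
have le1 : expR (- h) <= 1 by rewrite -expR0 ler_expR oppr_le0.
split; [|lra|lra].
have : expR (- h) * (1 + h) <= 1 by rewrite -[leRHS]ee ler_pM2l.
nra.
Qed.

Let mean_step (h x lo hi : R) : 0 <= h ->
  (forall s, 0 <= s <= h -> lo <= G (x - c * s) <= hi) ->
  expR (- h) * phi (x - c * h) + (1 - expR (- h)) * lo <= phi x <=
  expR (- h) * phi (x - c * h) + (1 - expR (- h)) * hi.
Proof. by move=> h0 lohi; rewrite !phiE; exact: expo_mean_step. Qed.

(** The memoryless step with the crude bounds 0 and 1 on [G] shows that [phi] changes by at most the
    mass [1 - expR (- h)], itself at most [h]. *)
Lemma front_increment (h x : R) : 0 <= h -> `|phi x - phi (x - c * h)| <= h.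
Proof.
move=> h0.
have /andP[H1 H2] : expR (- h) * phi (x - c * h) + (1 - expR (- h)) * 0 <= phi x <=
    expR (- h) * phi (x - c * h) + (1 - expR (- h)) * 1.
  by apply: mean_step => // s _; exact: mG.2.
have [_ r1 r0] := expN h0.
have /andP[p0 p1] := mphi.2 (x - c * h).
set p := phi (x - c * h) in H1 H2 p0 p1 *; set a := expR (- h) in H1 H2 r0 r1.
have : (1 - a) * p <= 1 - a by rewrite ler_piMr.
have : 0 <= (1 - a) * p by rewrite mulr_ge0.
rewrite ler_norml; move=> *; apply/andP; split; lra.
Qed.

Lemma source_increment (h x : R) : 0 <= h -> `|G x - G (x - c * h)| <= 2 * h.
Proof.
move=> h0.
have bd z : bdd_meas (fun y : measurableTypeR R => react f L (phi (z - y)) (phi z)).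
  apply: (react_bdd_meas L_gt1 f_lip f0 f1); [|exact: measurable_cst| |].
  - exact: (bdd_shift _ mphi).1.
  - by move=> y; exact: mphi.2.
  - by move=> y; exact: mphi.2.
have key z z' : (forall y, phi (z - y) <= phi (z' - y) + h) -> G z <= G z' + 2 * h.
  move=> H; rewrite -(expect_cst nu (2 * h)) -(expectD nu (bd z') (bdd_meas_cst _ _)).
  apply: expect_le => //; first exact: bdd_measD (bd z') (bdd_meas_cst _ _).
  move=> y; apply: le_trans (reactD_le L_gt1 f_lip _ _ h0).
  by apply: (react_le L_gt1 f_lip) => //; have := H 0; rewrite !subr0.
have D y : `|phi (x - y) - phi (x - c * h - y)| <= h.
  have := front_increment (x - y) h0.
  by rewrite (_ : x - y - c * h = x - c * h - y)//; ring.
rewrite ler_norml; apply/andP; split.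
  have := key (x - c * h) x; set A := G x; set B := G _ => H.
  suff : B <= A + 2 * h by lra.
  by apply: H => y; have := D y; rewrite ler_norml => /andP[]; lra.
have := key x (x - c * h); set A := G x; set B := G _ => H.
suff : A <= B + 2 * h by lra.
by apply: H => y; have := D y; rewrite ler_norml => /andP[]; lra.
Qed.

(** Second use of the memoryless step, now with [G] known up to [2 * h]. Of the factor 4, two come
    from this error, one from replacing [1 - expR (- h)] by [h] and one from replacing
    [phi (x - c * h)] by [phi x]. The bound is uniform in [x], as a derivative in the supremum norm
    requires. *)
Lemma front_expansion (h x : R) : 0 <= h ->
  `|phi x - phi (x - c * h) - h * (G x - phi x)| <= 4 * h ^+ 2.
Proof.
move=> h0.
have /andP[H1 H2] : expR (- h) * phi (x - c * h) + (1 - expR (- h)) * (G x - 2 * h) <=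
    phi x <= expR (- h) * phi (x - c * h) + (1 - expR (- h)) * (G x + 2 * h).
  apply: mean_step => // s /andP[s0 sh].
  have := source_increment x s0; rewrite ler_norml => /andP[A B].
  by apply/andP; split; lra.
have [r2 r1 r0] := expN h0.
have := front_increment x h0.
have /andP[p0 p1] := mphi.2 (x - c * h).
have /andP[g0 g1] := mG.2 x.
set p := phi (x - c * h) in H1 H2 p0 p1 *; set a := expR (- h) in H1 H2 r0 r1 r2.
set g := G x in H1 H2 g0 g1 *; set q := phi x in H1 H2 *.
rewrite ler_norml => /andP[d1 d2].
pose r := 1 - a; have ra : a = 1 - r by rewrite /r; ring.
rewrite ra in H1 H2 r0 r1 r2.
have r0' : 0 <= r by rewrite /r; lra.
have rh : r <= h by lra.
have hr : h - h ^+ 2 <= r by lra.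
have hr0 : 0 <= h - r by lra.
have e1 : `|(h - r) * (g - p)| <= h ^+ 2.
  rewrite normrM (ger0_norm hr0) -[leRHS]mulr1; apply: ler_pM => //; first lra.
  by rewrite ler_norml; apply/andP; split; lra.
have e2 : `|h * (q - p)| <= h ^+ 2.
  by rewrite normrM (ger0_norm h0) expr2 ler_wpM2l// ler_norml d1 d2.
have e3 : r * h <= h ^+ 2 by rewrite expr2 ler_wpM2r.
move: e1 e2; rewrite !ler_norml => /andP[e11 e12] /andP[e21 e22].
have E : q - p - h * (g - q) = (q - p - r * (g - p)) - (h - r) * (g - p) + h * (q - p) by ring.
rewrite E; apply/andP; split; nra.
Qed.

Lemma front_solution : is_Linf_solution nu f (fun t x => phi (x + c * L * t)).
Proof.
split=> [t|t e e0].
  split; first exact: (mon_measurable (mon_shift _ mphi)).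
  exists 1 => x; have /andP[p0 p1] := mphi.2 (x + c * L * t).
  by rewrite ger0_norm.
have L2 : 0 < 7 * L ^+ 2 by rewrite mulr_gt0// exprn_gt0.
(* The remainder is at most [7 * (L * h) ^+ 2], where 7 is 4 from [front_expansion] plus 3 from
   recentring; dividing by [h] fixes the admissible range. *)
exists (e / (7 * L ^+ 2)); first by rewrite divr_gt0.
move=> h /andP[h0]; rewrite ltr_pdivlMr// => he; apply: aeW => x.
have convE : Defs.conv nu (fun x => phi (x + c * L * t)) x = Defs.conv nu phi (x + c * L * t).
  by rewrite /Defs.conv; congr fine; apply: eq_integral => y _; congr (phi _)%:E; ring.
rewrite convE -sourceE//; set X := x + c * L * t.
have {convE} -> : x + c * L * (t + h) = X + c * (L * h) by rewrite /X; ring.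
suff : `|phi (X + c * (L * h)) - phi X - L * h * (G X - phi X)| <= 7 * (L * h) ^+ 2.
  move=> H; have h0' : h != 0 by rewrite -normr_gt0.
  have -> : (phi (X + c * (L * h)) - phi X) / h - L * (source phi X - phi X) =
    (phi (X + c * (L * h)) - phi X - L * h * (G X - phi X)) / h.
    by rewrite -/G; field.
  rewrite normrM normfV ler_pdivrMr// (le_trans H)//.
  have -> : 7 * (L * h) ^+ 2 = (`|h| * (7 * L ^+ 2)) * `|h|.
    by rewrite exprMn -(real_normK (num_real h)); ring.
  by rewrite ler_pM2r// ltW.
(* [front_expansion] looks back from its base point. For [h >= 0] it is used at [X + c * k] with
   [k = L * h], and moving [G] and [phi] back to [X] costs [3 * k ^+ 2]; for [h < 0] it applies at
   [X] directly. *)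
have [h1|h1] := leP 0 h.
  have k0 : 0 <= L * h by rewrite mulr_ge0// ltW.
  move: k0; move: (L * h) => k k0.
  have A := front_expansion (X + c * k) k0; have B := source_increment (X + c * k) k0.
  have C := front_increment (X + c * k) k0.
  rewrite addrK in A B C.
  have E : phi (X + c * k) - phi X - k * (G X - phi X) =
    (phi (X + c * k) - phi X - k * (G (X + c * k) - phi (X + c * k))) +
    (k * (G (X + c * k) - G X) - k * (phi (X + c * k) - phi X)) by ring.
  rewrite E (le_trans (ler_normD _ _))//.
  have : `|k * (G (X + c * k) - G X) - k * (phi (X + c * k) - phi X)| <= 3 * k ^+ 2.
    rewrite (le_trans (ler_normB _ _))// !normrM (ger0_norm k0).
    have := ler_wpM2l k0 B; have := ler_wpM2l k0 C; rewrite expr2; lra.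
  lra.
have k0 : 0 <= L * - h by rewrite mulr_ge0 ?oppr_ge0// ltW.
have A := front_expansion X k0.
have k2 : 0 <= (L * h) ^+ 2 by exact: sqr_ge0.
have e2 : (L * - h) ^+ 2 = (L * h) ^+ 2 by ring.
rewrite e2 in A.
have -> : phi (X + c * (L * h)) - phi X - L * h * (G X - phi X) =
  - (phi X - phi (X - c * (L * - h)) - L * - h * (G X - phi X)).
  have -> : X - c * (L * - h) = X + c * (L * h) by ring.
  by ring.
by rewrite normrN; lra.
Qed.

End Fixed.
End FrontSolution.

(** * Limits at infinity, linear bounds at [alpha] and the stationary step *)

Lemma left_limit_cvg (R : realType) (phi : R -> R) k : mon phi ->
  left_limit phi k -> phi @ -oo --> k.
Proof.
move=> mphi [kl ke]; apply/cvgrPdist_le => e e0; have [x xk] := ke e e0.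
near=> y; rewrite distrC ger0_norm ?subr_ge0// lerBlDl.
apply: le_trans (ltW xk); apply: mphi.1; near: y.
by apply: nbhs_ninfty_le; exact: num_real.
Unshelve. all: by end_near. Qed.

Lemma right_limit_cvg (R : realType) (phi : R -> R) k : mon phi ->
  right_limit phi k -> phi @ +oo --> k.
Proof.
move=> mphi [kl ke]; apply/cvgrPdist_le => e e0; have [x xk] := ke e e0.
near=> y; rewrite ger0_norm ?subr_ge0// lerBlDr addrC -lerBlDr.
apply: le_trans (ltW xk) _; apply: mphi.1; near: y.
by apply: nbhs_pinfty_ge; exact: num_real.
Unshelve. all: by end_near. Qed.

(** Near [alpha], on both sides, the difference quotient exceeds half the derivative; halving the
    radius keeps the closed range [u <= eta] inside the open ball. *)
Lemma derive1_gt0_linear (R : realType) (f : R -> R) (alpha : R) :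
  derivable f alpha 1 -> f alpha = 0 -> 0 < derive1 f alpha ->
  exists delta eta : R, [/\ 0 < delta, 0 < eta,
    forall u, 0 <= u <= eta -> delta * u <= f (alpha + u) &
    forall u, 0 <= u <= eta -> f (alpha - u) <= - (delta * u)].
Proof.
move=> df fa D0; set D := derive1 f alpha in D0.
have cD : (fun h : R => h^-1 *: ((f \o shift alpha) (h *: 1) - f alpha)) @ 0^' --> D.
  by rewrite /D derive1E; exact: df.
have D2 : D / 2 < D by lra.
have [e /= e0 He] := cvgr_gt D cD _ D2.
have {}He h : h != 0 -> `|h| < e -> D / 2 < h^-1 * f (alpha + h).
  move=> h0 he; have := He h; rewrite /ball/= sub0r normrN => /(_ he h0).
  by rewrite /shift/= fa subr0 /GRing.scale/= mulr1 (addrC h).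
exists (D / 2), (e / 2); split; [lra|lra| |].
- move=> u /andP[]; rewrite le_eqVlt => /predU1P[<-|u0] ue.
    by rewrite mulr0 addr0 fa.
  have un0 : u != 0 by rewrite gt_eqF.
  have := He u un0; rewrite gtr0_norm// [u^-1 * _]mulrC ltr_pdivlMr// => H; apply/ltW/H; lra.
- move=> u /andP[]; rewrite le_eqVlt => /predU1P[<-|u0] ue.
    by rewrite mulr0 subr0 oppr0 fa.
  have un0 : - u != 0 by rewrite oppr_eq0 gt_eqF.
  have := He (- u) un0; rewrite normrN gtr0_norm// invrN mulNr -mulrN [u^-1 * _]mulrC.
  rewrite ltr_pdivlMr// => H; rewrite lerNr; apply/ltW/H; lra.
Qed.

(** For the point mass at 0 the convolution is the identity, and [f] vanishes at both values of the
    step, so the right-hand side is 0. *)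
Lemma heaviside_solution (R : realType)
    (mu : {measure set (measurableTypeR R) -> \bar R}) (f : R -> R) :
  mu [set: measurableTypeR R] = 1%E -> f 0 = 0 -> f 1 = 0 ->
  {ae mu, forall y : measurableTypeR R, (y : R) = 0} ->
  is_Linf_solution mu f (fun t x => (0 <= x + 0 * t)%R%:R).
Proof.
move=> mu1 f0 f1 mu0; pose H (x : R) : R := (0 <= x)%R%:R.
have mH : measurable_fun setT (H : measurableTypeR R -> R).
  apply: nondecreasing_measurable => // x y xy; rewrite /H ler_nat.
  by case: (boolP (0 <= x)) => // x0; rewrite (le_trans x0 xy).
have E t : (fun x => (0 <= x + 0 * t)%R%:R) = H.
  by apply/funext => x; rewrite mul0r addr0.
split=> [t|t e e0].
  rewrite E; split => //; exists 1 => x.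
  by rewrite normr_nat lern1; case: (0 <= _)%R.
exists 1 => // h _; apply: aeW => x; rewrite !E !mul0r !addr0 subrr mul0r sub0r normrN -/(H x).
have fH : f (H x) = 0 by rewrite /H; case: (0 <= x); rewrite ?mulr1n ?mulr0n.
have -> : Defs.conv mu H x = H x.
  rewrite /Defs.conv (_ : (\int[mu]_y (H (x - y))%:E = \int[mu]_y (H x)%:E)%E).
    by rewrite integral_cst// mu1 mule1.
  apply: ae_eq_integral => //.
    by apply/measurable_EFinP; apply: (measurableT_comp mH); exact: measurable_funB.
  by apply: filterS mu0 => y -> _; rewrite subr0.
by rewrite subrr fH addr0 normr0 ltW.
Qed.

Unset Implicit Arguments.
Set Strict Implicit.

Theorem theorem1 (R : realType)
  (mu : {measure set (measurableTypeR R) -> \bar R})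
  (f : R -> R) (alpha : R) :
  mu [set: measurableTypeR R] = 1%E ->
  (forall x : R, derivable f x 1) -> continuous (derive1 f) ->
  (exists L : R, forall x y : R, `|f x - f y| <= L * `|x - y|) ->
  0 < alpha < 1 ->
  f 0 = 0 -> f alpha = 0 -> f 1 = 0 ->
  (forall x : R, 0 < x < alpha -> f x < 0) ->
  (forall x : R, alpha < x < 1 -> 0 < f x) ->
  0 < derive1 f alpha ->
  exists (c : R) (phi : R -> R),
    {homo phi : x y / x <= y} /\
    phi @ -oo --> (0 : R) /\ phi @ +oo --> (1 : R) /\
    is_Linf_solution mu f (fun t x => phi (x + c * t)).
Proof.
move=> mu1 df _ [Lf f_lipschitz] alpha_itv f0 falpha f1 f_neg f_pos f'alpha.
(* The point mass at 0 escapes the drift contradiction and is settled by the step function. *)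
have [mu0|mu_neq0] := pselect {ae mu, forall y : measurableTypeR R, (y : R) = 0}.
  exists 0, (fun x => (0 <= x)%R%:R); split.
    by move=> x y xy; rewrite ler_nat; case: (boolP (0 <= x)) => // /le_trans->.
  split; last split; last exact: heaviside_solution.
    apply/cvgrPdist_le => e e0; near=> x.
    have x0 : x < 0 by near: x; apply: nbhs_ninfty_lt; exact: num_real.
    by rewrite [(0 <= x)%R]leNgt x0/= subrr normr0 ltW.
  apply/cvgrPdist_le => e e0; near=> x.
  have x0 : 0 <= x by near: x; apply: nbhs_pinfty_ge; exact: num_real.
  by rewrite x0 subrr normr0 ltW.
(* This exceeds 1 and makes [L - 1] a Lipschitz constant of [f]. *)
pose L := `|Lf| + 2.
have L_gt1 : 1 < L by rewrite /L; have := normr_ge0 Lf; lra.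
have f_lip x y : `|f x - f y| <= (L - 1) * `|x - y|.
  apply: le_trans (f_lipschitz x y) _; apply: ler_wpM2r => //.
  by rewrite /L; have := ler_norm Lf; lra.
pose nu := prob_of_measure mu1.
have mexpo : measurable_fun setT
    (fun w : measurableTypeR R * measurableTypeR R => expo w.1).
  exact: (measurableT_comp (@measurable_expo R) measurable_fst).
have nu_neq0 : ~ {ae prod_prob (unif01 R) nu, forall w, (w.2 : R) = 0}.
  have mid : measurable_fun setT (fun y : measurableTypeR R => y : R) by exact: measurable_id.
  by move=> /(prod_prob_ae_snd mid); exact: mu_neq0.
have [delta [eta [d0 e0 f_right f_left]]] :=
  derive1_gt0_linear (df alpha) falpha f'alpha.
have [c [phi [mphi fix_phi phil phir]]] := front_exists mexpo
  (measurable_snd : measurable_fun setT (fun w : measurableTypeR R * measurableTypeR R => w.2 : R))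
  (fun w => expo_gt0 w.1) L_gt1 f_lip f0 f1 alpha_itv falpha f_neg f_pos
  d0 e0 f_right f_left nu_neq0.
(* The fixed-point problem measures speed in units of [L]. *)
exists (c * L), phi; split; first exact: mphi.1.
split; first exact: left_limit_cvg.
split; first exact: right_limit_cvg.
exact: (front_solution L_gt1 f_lip f0 f1 mphi fix_phi).
Unshelve. all: by end_near. Qed.
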